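(* Let $H$ be a Hopf algebroid over $B$. Then $B\subseteq P$ is an anti-cleft extension over $H$ (i.e. $P$ is an anti-cleft right $H$-comodule algebra with $P^{\mathrm{co}H}=B$) if and only if $P\cong{}_\Gamma H$ (as right $H$-comodule algebras) for some invertible 2-cocycle $\Gamma$ on $H$.
   Context: Let $k$ be a field, $B$ a unital $k$-algebra, $\overline B$ its opposite algebra, $b\mapsto\bar b$ the canonical anti-isomorphism $B\to\overline B$. $\otimes_B,\otimes_{\overline B}$ are the usual balanced tensor products; $M\diamond_BN=M\otimes N/\langle\bar bm\otimes n-m\otimes bn\rangle$. The Takeuchi product $M\times_BN\subseteq M\diamond_BN$ consists of the $\sum m_i\otimes n_i$ with $\sum m_i\bar a\otimes n_i=\sum m_i\otimes n_ia$ for all $a\in B$. A left bialgebroid over $B$ is an algebra $H$ with algebra maps $s:B\to H$, $t:\overline B\to H$ with commuting images (one writes $b,\bar b$ for $s(b),t(\bar b)$ in products), a coassociative algebra map $\Delta:H\to H\times_BH$, $X\mapsto X_{(1)}\otimes X_{(2)}$, with $\Delta(b\bar cX)=bX_{(1)}\otimes\bar cX_{(2)}$, and $\varepsilon:H\to B$ with $\varepsilon(b\bar cX)=b\varepsilon(X)c$, $\varepsilon(X_{(1)})X_{(2)}=X=\overline{\varepsilon(X_{(2)})}X_{(1)}$, $\varepsilon(1)=1$, $\varepsilon(X\varepsilon(Y))=\varepsilon(XY)=\varepsilon(X\overline{\varepsilon(Y)})$. It is a Hopf algebroid if $\lambda:H\otimes_{\overline B}H\to H\diamond_BH$, $X\otimes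 Y\mapsto X_{(1)}\otimes X_{(2)}Y$ and $\mu:H\otimes_BH\to H\diamond_BH$, $X\otimes Y\mapsto X_{(1)}Y\otimes X_{(2)}$ are bijective; write $X_+\otimes X_-=\lambda^{-1}(X\otimes1)$, $X_{[+]}\otimes X_{[-]}=\mu^{-1}(1\otimes X)$. A right $H$-comodule is a left $\overline B$-module $P$ with coassociative counital coaction $p\mapsto p_{(0)}\otimes p_{(1)}\in P\diamond_BH$, $\bar bp\mapsto p_{(0)}\otimes\bar bp_{(1)}$; it is a $\overline B$-bimodule by $p\bar b=\overline{\varepsilon(p_{(1)}b)}p_{(0)}$. A right $H$-comodule algebra is a $\overline B$-ring with right comodule structure whose coaction is a map of $\overline B$-rings $P\to P\times_BH$. $P^{\mathrm{co}H}=\{p:p_{(0)}\otimes p_{(1)}=p\otimes1\}$. $P$ is reversible if $P\otimes_{\overline B}H\to P\diamond_BH$, $p\otimes X\mapsto p_{(0)}\otimes p_{(1)}X$ is bijective. Anti-cleft: $P$ is reversible, $B$ is a subalgebra of $P^{\mathrm{co}H}$, and there is a right $H$-colinear, left $B$-linear $\tilde\rho:H\to P$ for which there is a left $\overline B$-linear, right $B$-linear $\rho:H\to P$ with $\tilde\rho(X_+)\rho(X_-)=\varepsilon(X)1_P$ and $\rho(X_{[+]})\tilde\rho(X_{[-]})=\overline{\varepsilon(X)}1_P$. An invertible 2-cocycle on $H$ is a map $\Gamma:H\otimes_{\overline B}H\to B$ with $\Gamma(b\bar cX,Y)=b\Gamma(X,Y)c$, $\Gamma(X,\Gamma(Y_{(1)},Z_{(1)})Y_{(2)}Z_{(2)})=\Gamma(\Gamma(X_{(1)},Y_{(1)})X_{(2)}Y_{(2)},Z)$,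 $\Gamma(1,X)=\varepsilon(X)=\Gamma(X,1)$, such that there is $\Gamma^{-1}:H\otimes_BH\to B$ with $\Gamma^{-1}(b\bar cX,Y)=b\Gamma^{-1}(X,Y)c$, $\Gamma^{-1}(X,\bar bY)=\Gamma^{-1}(X_{(1)},Y)\Gamma^{-1}(X_{(2)},\bar b)$, $\Gamma(X_{(1)},Y_{(1)})\Gamma^{-1}(X_{(2)},Y_{(2)})=\Gamma(X,\varepsilon(Y))$, $\Gamma^{-1}(X_{(1)},Y_{(1)})\Gamma(X_{(2)},Y_{(2)})=\varepsilon(XY)$. ${}_\Gamma H$ is $H$ as a right $H$-comodule (coaction $\Delta$, $\overline B\to{}_\Gamma H$ given by $t$) with the multiplication $X\cdot Y=\Gamma(X_{(1)},Y_{(1)})X_{(2)}Y_{(2)}$. *)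

(* Defs.v *)
From HB Require Import structures.
From mathcomp Require Import all_boot all_order all_algebra.
From mathcomp Require Import generic_quotient ring_quotient.
From mathcomp Require Import finmap boolp.
From mathcomp.multinomials Require Import monalg.

Set Implicit Arguments.
Unset Strict Implicit.
Unset Printing Implicit Defensive.

Import GRing.Theory.

Local Open Scope ring_scope.
Local Open Scope quotient_scope.

(* The opposite algebra of B is the converse ring B^c of MathComp, with the
   same carrier: the anti-isomorphism b |-> \bar b is the identity.  MathComp
   only provides its ring structure; scalars act as on B. *)
HB.instance Definition _ (R : pzRingType) (V : lmodType R) :=
  GRing.Lmodule.on V^c.

Lemma converse_scalerAl (R : pzRingType) (A : algType R) (a : R) (x y : A^c) :
  a *: (x * y) = (a *: x : A^c) * y.
Proof. exact: (@scalerAr R A a y x). Qed.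

HB.instance Definition _ (R : pzRingType) (A : algType R) :=
  GRing.LSemiModule_isLSemiAlgebra.Build R A^c (@converse_scalerAl R A).

Lemma converse_scalerAr (R : pzRingType) (A : algType R) (a : R) (x y : A^c) :
  a *: (x * y) = x * (a *: y : A^c).
Proof. exact: (@scalerAl R A a y x). Qed.

HB.instance Definition _ (R : pzRingType) (A : algType R) :=
  GRing.LSemiAlgebra_isSemiAlgebra.Build R A^c (@converse_scalerAr R A).

(* [tensor f g] is the quotient of the tensor product over k of M and N by the
   subspace spanned by all f i m (x) n - m (x) g i n. *)
Section Tensor.
Variables (k : fieldType) (M N : lmodType k) (I : Type).
Variables (f : I -> M -> M) (g : I -> N -> N).

Definition free_tensor := {malg k[(M * N)%type]}.
Definition gen (m : M) (n : N) : free_tensor := << (m, n) >>.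

Inductive tensor_rel : free_tensor -> Prop :=
| RelAddl m m' n : tensor_rel (gen (m + m') n - gen m n - gen m' n)
| RelAddr m n n' : tensor_rel (gen m (n + n') - gen m n - gen m n')
| RelScalel c m n : tensor_rel (gen (c *: m) n - c *: gen m n)
| RelScaler c m n : tensor_rel (gen m (c *: n) - c *: gen m n)
| RelBal i m n : tensor_rel (gen (f i m) n - gen m (g i n)).

Inductive tensor_span : free_tensor -> Prop :=
| Span0 : tensor_span 0
| SpanD c r x : tensor_rel r -> tensor_span x -> tensor_span (c *: r + x).

Lemma tensor_spanD x y : tensor_span x -> tensor_span y -> tensor_span (x + y).
Proof.
by elim=> [|c r z rr _ IH] ys; rewrite ?add0r // -addrA; apply: SpanD (IH ys).
Qed.

Lemma tensor_spanZ c x : tensor_span x -> tensor_span (c *: x).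
Proof.
elim=> [|d r z rr _ IH]; first by rewrite scaler0; exact: Span0.
by rewrite scalerDr scalerA; apply: SpanD IH.
Qed.

Lemma tensor_rel_span r : tensor_rel r -> tensor_span r.
Proof. by move=> rr; rewrite -[r]addr0 -[r]scale1r; apply: SpanD Span0. Qed.

Definition tensor_pred : {pred free_tensor} := fun x => `[< tensor_span x >].

Lemma tensor_pred_zmod : zmod_closed tensor_pred.
Proof.
split=> [|x y /asboolP xs /asboolP ys]; apply/asboolP; first exact: Span0.
by apply: tensor_spanD => //; rewrite -scaleN1r; apply: tensor_spanZ.
Qed.

HB.instance Definition _ :=
  GRing.isZmodClosed.Build free_tensor tensor_pred tensor_pred_zmod.

Definition tensor : Type := Quotient.quot tensor_pred.
HB.instance Definition _ := GRing.Zmodule.on tensor.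

Definition tcls (x : free_tensor) : tensor := \pi_(Quotient.quot tensor_pred) x.

Lemma tcls_eq x y : tcls x = tcls y <-> tensor_span (x - y).
Proof.
split=> [e|e]; last first.
  by apply/eqP; rewrite -[_ == _]Quotient.idealrBE; apply/asboolP.
by apply/asboolP; move/eqP: e; rewrite -[_ == _]Quotient.idealrBE.
Qed.

Lemma tclsD x y : tcls (x + y) = tcls x + tcls y.
Proof. exact: (raddfD (\pi_(Quotient.quot tensor_pred))). Qed.

Lemma tcls_repr (t : tensor) : tcls (repr (t : Quotient.quot tensor_pred)) = t.
Proof. exact: reprK. Qed.

Definition tscale (c : k) (t : tensor) : tensor :=
  tcls (c *: repr (t : Quotient.quot tensor_pred)).

Lemma tscaleE c x : tscale c (tcls x) = tcls (c *: x).
Proof.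
apply/tcls_eq; rewrite -scalerBr; apply/tensor_spanZ/tcls_eq.
exact: tcls_repr.
Qed.

Lemma tscaleA a b t : tscale a (tscale b t) = tscale (a * b) t.
Proof. by rewrite -[t]tcls_repr !tscaleE scalerA. Qed.
Lemma tscale1 : left_id 1 tscale.
Proof. by move=> t; rewrite -[t]tcls_repr !tscaleE scale1r. Qed.
Lemma tscaleDr : right_distributive tscale +%R.
Proof.
move=> a t u; rewrite -[t]tcls_repr -[u]tcls_repr -tclsD !tscaleE.
by rewrite scalerDr tclsD.
Qed.
Lemma tscaleDl t : {morph tscale^~ t : a b / a + b}.
Proof. by move=> a b; rewrite -[t]tcls_repr !tscaleE scalerDl tclsD. Qed.

HB.instance Definition _ :=
  GRing.Zmodule_isLmodule.Build k tensor tscaleA tscale1 tscaleDr tscaleDl.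

Definition tns (m : M) (n : N) : tensor := tcls (gen m n).

(* The map out of the tensor product induced by phi, i.e. the value of
   "\sum_i phi m_i n_i" at t = \sum_i m_i (x) n_i.  It is computed on a chosen
   representative of t, so it is meaningful when phi is balanced (or when phi
   becomes so once summed over the other variables, as for products in the
   Takeuchi product). *)
Definition tlift (V : lmodType k) (t : tensor) (phi : M -> N -> V) : V :=
  let x := repr (t : Quotient.quot tensor_pred) in
  \sum_(p <- msupp x) x@_p *: phi p.1 p.2.

Definition balanced (V : lmodType k) (phi : M -> N -> V) : Prop :=
  [/\ forall n, linear (phi^~ n), forall m, linear (phi m)
    & forall i m n, phi (f i m) n = phi m (g i n)].
End Tensor.

Arguments tns {k M N I f g} m n.
Arguments tlift {k M N I f g V} t phi.

Notation "m ⊗ n" := (tns m n) (at level 45, left associativity) : ring_scope.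

Section TensorTheory.
Variables (k : fieldType) (M N : lmodType k) (I : Type).
Variables (f : I -> M -> M) (g : I -> N -> N).
Notation tensor := (tensor f g).

Lemma tns_balanced : balanced f g (fun m n => m ⊗ n : tensor).
Proof.
have Z c x : tcls f g (c *: x) = c *: tcls f g x by rewrite -tscaleE.
have B x y : tensor_span f g (x - y) -> tcls f g x = tcls f g y.
  by move/tcls_eq.
split=> [n c m m1|m c n n1|i m n] /=; rewrite /tns -?Z -?tclsD.
- transitivity (tcls f g (gen (c *: m) n + gen m1 n)).
    by apply: B; rewrite opprD addrA; apply/tensor_rel_span/RelAddl.
  by apply: B; rewrite opprD addrACA subrr addr0; apply/tensor_rel_span/RelScalel.
- transitivity (tcls f g (gen m (c *: n) + gen m n1)).
    by apply: B; rewrite opprD addrA; apply/tensor_rel_span/RelAddr.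
  by apply: B; rewrite opprD addrACA subrr addr0; apply/tensor_rel_span/RelScaler.
- by apply: B; apply/tensor_rel_span/RelBal.
Qed.

Section Lift.
Variables (V : lmodType k) (phi : M -> N -> V).
Hypothesis phiB : balanced f g phi.

Let ev (x : free_tensor M N) : V := \sum_(p <- msupp x) x@_p *: phi p.1 p.2.

Let evw (d : {fset (M * N)%type}) x : (msupp x `<=` d)%fset ->
  ev x = \sum_(p <- d) x@_p *: phi p.1 p.2.
Proof.
move=> sxd; rewrite /ev (big_fset_incl _ sxd) //= => p _ pNx.
by rewrite mcoeff_outdom // scale0r.
Qed.

Let ev_lin : linear ev.
Proof.
move=> c x y; pose d := (msupp x `|` msupp y `|` msupp (c *: x + y))%fset.
have sx : (msupp x `<=` d)%fset by rewrite /d -fsetUA fsubsetUl.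
have sy : (msupp y `<=` d)%fset by rewrite /d fsetUAC fsubsetUr.
have sxy : (msupp (c *: x + y) `<=` d)%fset by rewrite /d fsubsetUr.
rewrite (evw sx) (evw sy) (evw sxy).
rewrite scaler_sumr -big_split /=; apply: eq_bigr => p _.
by rewrite mcoeffD mcoeffZ scalerDl scalerA.
Qed.

Let evD x y : ev (x + y) = ev x + ev y.
Proof. by have := ev_lin 1 x y; rewrite !scale1r. Qed.
Let ev0 : ev 0 = 0.
Proof. by apply: (addIr (ev 0)); rewrite -evD !add0r. Qed.
Let evZ c x : ev (c *: x) = c *: ev x.
Proof. by have := ev_lin c x 0; rewrite addr0 ev0 addr0. Qed.
Let evN x : ev (- x) = - ev x.
Proof. by rewrite -[- x]scaleN1r evZ scaleN1r. Qed.

Let ev_gen m n : ev (gen m n) = phi m n.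
Proof.
rewrite (@evw [fset (m, n)]%fset) ?msuppU_le // big_seq_fset1.
by rewrite mcoeffUU scale1r.
Qed.

Let ev_span x : tensor_span f g x -> ev x = 0.
Proof.
have [pl pr pb] := phiB.
elim=> [|c r z rr _ IH]; first exact: ev0.
rewrite evD evZ IH addr0; case: rr => [m m' n|m n n'|d m n|d m n|i m n].
- have := pl n 1 m m'; rewrite !evD !evN !ev_gen !scale1r => ->.
  by rewrite addrAC addrK subrr scaler0.
- have := pr m 1 n n'; rewrite !evD !evN !ev_gen !scale1r => ->.
  by rewrite addrAC addrK subrr scaler0.
- have z0 : phi 0 n = 0.
    by have := pl n (-1) 0 0; rewrite scaler0 addr0 scaleN1r addNr.
  have := pl n d m 0; rewrite !evD !evN evZ !ev_gen addr0 z0 addr0 => ->.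
  by rewrite subrr scaler0.
- have z0 : phi m 0 = 0.
    by have := pr m (-1) 0 0; rewrite scaler0 addr0 scaleN1r addNr.
  have := pr m d n 0; rewrite !evD !evN evZ !ev_gen addr0 z0 addr0 => ->.
  by rewrite subrr scaler0.
- by rewrite evD evN !ev_gen pb subrr scaler0.
Qed.

Let tlift_tcls x : tlift (tcls f g x) phi = ev x.
Proof.
apply/eqP; rewrite -subr_eq0 -evN -evD; apply/eqP/ev_span/tcls_eq.
exact: tcls_repr.
Qed.

Lemma tlift_tns m n : tlift (m ⊗ n : tensor) phi = phi m n.
Proof. by rewrite tlift_tcls ev_gen. Qed.

Lemma tlift_linear : linear (fun t : tensor => tlift t phi).
Proof.
move=> c t u; rewrite -[t]tcls_repr -[u]tcls_repr -[_ *: _]/(tscale _ _) tscaleE.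
by rewrite -tclsD !tlift_tcls ev_lin.
Qed.
End Lift.

Lemma tensor_ind (P : tensor -> Prop) :
  P 0 -> (forall m n t, P t -> P (m ⊗ n + t)) -> forall t, P t.
Proof.
have [pl _ _] := tns_balanced.
have Z c x : tcls f g (c *: x) = c *: tcls f g x by rewrite -tscaleE.
move=> P0 PD t; rewrite -[t]tcls_repr [repr _]monalgE.
elim: (finmap.enum_fset _) => [|[m n] l IH].
  by rewrite big_nil -[0](scale0r 0) Z scale0r.
rewrite big_cons tclsD; set c := _@_ _.
have -> : tcls f g << c *g (m, n) >> = (c *: m) ⊗ n.
  have -> : << c *g (m, n) >> = c *: gen m n.
    by apply/malgP => p; rewrite mcoeffZ !mcoeffU mulr_natr.
  have z0 : (0 : M) ⊗ n = 0 :> tensor.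
    by have := pl n (-1) 0 0; rewrite scaler0 addr0 scaleN1r addNr.
  by have := pl n c m 0; rewrite !addr0 z0 addr0 /= => ->; rewrite Z.
exact: PD.
Qed.

Lemma linear_tlift (V W : lmodType k) (L : V -> W) (t : tensor) phi :
  linear L -> L (tlift t phi) = tlift t (fun m n => L (phi m n)).
Proof.
move=> hL.
have LD x y : L (x + y) = L x + L y by have := hL 1 x y; rewrite !scale1r.
have L0 : L 0 = 0 by apply: (addIr (L 0)); rewrite -LD !add0r.
have LZ c x : L (c *: x) = c *: L x by have := hL c x 0; rewrite L0 !addr0.
by rewrite /tlift (big_morph L LD L0); apply: eq_bigr => p _; exact: LZ.
Qed.

Lemma eq_tlift (V : lmodType k) (t : tensor) (phi psi : M -> N -> V) :
  (forall m n, phi m n = psi m n) -> tlift t phi = tlift t psi.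
Proof. by move=> h; apply: eq_bigr => p _; rewrite h. Qed.

Lemma tliftZD (V : lmodType k) (t : tensor) c (phi psi : M -> N -> V) :
  tlift t (fun m n => c *: phi m n + psi m n) = c *: tlift t phi + tlift t psi.
Proof.
rewrite /tlift scaler_sumr -big_split; apply: eq_bigr => p _ /=.
by rewrite scalerDr !scalerA mulrC.
Qed.
End TensorTheory.

(* Throughout, an algebra A over k with u : B^c -> A is a left module over the
   opposite algebra of B by b . a = u b * a, and a bimodule by multiplication
   on both sides (see [comodule_ractE] for comodule algebras). *)

(* [balanced_tensor u v] is A (x)_R C for the right R-module structure
   a . b = a * u b and the left R-module structure b . c = v b * c. *)
Definition balanced_tensor (k : fieldType) (R : Type) (A C : algType k)
    (u : R -> A) (v : R -> C) : lmodType k :=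
  tensor (fun b a => a * u b) (fun b c => v b * c).

Section Diamond.
Variables (k : fieldType) (B H A : algType k).
Variables (s : {lrmorphism B -> H}) (t : {lrmorphism B^c -> H}).
Variable u : {lrmorphism B^c -> A}.

Definition diamond : lmodType k :=
  tensor (fun (b : B) (a : A) => u b * a) (fun (b : B) (x : H) => s b * x).

(* A <> H <> H, as (A <> H) <> H where b acts on A <> H by a (x) \bar b x. *)
Definition diamond3 : lmodType k :=
  tensor
    (fun (b : B) (z : diamond) => tlift z (fun a x => a ⊗ (t b * x) : diamond))
    (fun (b : B) (x : H) => s b * x).

Definition takeuchi (z : diamond) : Prop :=
  forall b : B, tlift z (fun a x => (a * u b) ⊗ x : diamond)
              = tlift z (fun a x => a ⊗ (x * s b)).

(* The product of the Takeuchi product; its outer sum is balanced when z is in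
   the Takeuchi product. *)
Definition dmul (z w : diamond) : diamond :=
  tlift w (fun c y => tlift z (fun a x => (a * c) ⊗ (x * y))).
End Diamond.

Record left_bialgebroid (k : fieldType) (B : algType k) := LeftBialgebroid {
  bgd :> algType k;
  src : {lrmorphism B -> bgd};
  tgt : {lrmorphism B^c -> bgd};
  comul : {linear bgd -> diamond src tgt};
  counit : {linear bgd -> B};
  src_tgtC : forall b c : B, src b * tgt c = tgt c * src b;
  comul_takeuchi : forall x, takeuchi (comul x);
  comul1 : comul 1 = 1 ⊗ 1;
  comulM : forall x y : bgd, comul (x * y) = dmul (comul x) (comul y);
  comul_bimod : forall (b c : B) x,
    comul (src b * tgt c * x)
    = tlift (comul x) (fun x1 x2 => (src b * x1) ⊗ (tgt c * x2));
  comulA : forall x,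
    tlift (comul x) (fun x1 x2 => comul x1 ⊗ x2 : diamond3 src tgt tgt)
    = tlift (comul x) (fun x1 x2 =>
        tlift (comul x2) (fun x3 x4 => (x1 ⊗ x3) ⊗ x4));
  counit_bimod : forall (b c : B) x,
    counit (src b * tgt c * x) = b * counit x * c;
  counitl : forall x,
    tlift (comul x) (fun x1 x2 => src (counit x1) * x2) = x;
  counitr : forall x,
    tlift (comul x) (fun x1 x2 => tgt (counit x2) * x1) = x;
  counit1 : counit 1 = 1;
  counit_src : forall x y, counit (x * src (counit y)) = counit (x * y);
  counit_tgt : forall x y, counit (x * tgt (counit y)) = counit (x * y)
}.

(* a (x) X |-> a_0 (x) a_1 X; this is lambda for A = H, d = comul H. *)
Definition can (k : fieldType) (B : algType k) (H : left_bialgebroid B)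
    (A : algType k) (u : {lrmorphism B^c -> A}) (d : A -> diamond (src H) u)
    (z : balanced_tensor u (tgt H)) : diamond (src H) u :=
  tlift z (fun a x => tlift (d a) (fun a0 a1 => a0 ⊗ (a1 * x))).

Section Hopf.
Variables (k : fieldType) (B : algType k) (H : left_bialgebroid B).

Definition HtH : lmodType k := balanced_tensor (tgt H) (tgt H).
Definition HsH : lmodType k := balanced_tensor (src H) (src H).

Definition lambda : HtH -> diamond (src H) (tgt H) := can (comul H).

Definition mu (z : HsH) : diamond (src H) (tgt H) :=
  tlift z (fun x y => tlift (comul H x) (fun x1 x2 => (x1 * y) ⊗ x2)).
End Hopf.

Record hopf_algebroid (k : fieldType) (B : algType k) := HopfAlgebroid {
  hopf_bgd :> left_bialgebroid B;
  lambda_inv : diamond (src hopf_bgd) (tgt hopf_bgd) -> HtH hopf_bgd;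
  lambdaK : cancel (@lambda k B hopf_bgd) lambda_inv;
  lambda_invK : cancel lambda_inv (@lambda k B hopf_bgd);
  mu_inv : diamond (src hopf_bgd) (tgt hopf_bgd) -> HsH hopf_bgd;
  muK : cancel (@mu k B hopf_bgd) mu_inv;
  mu_invK : cancel mu_inv (@mu k B hopf_bgd)
}.

(* X_+ (x) X_- and X_[+] (x) X_[-]. *)
Definition translp (k : fieldType) (B : algType k) (H : hopf_algebroid B)
  (x : H) : HtH H := lambda_inv (x ⊗ 1).
Definition transrp (k : fieldType) (B : algType k) (H : hopf_algebroid B)
  (x : H) : HsH H := mu_inv (1 ⊗ x).

(* That the ring structure makes the coaction unital is the case b = 1 of
   [coact_bar]. *)
Record comodule_algebra (k : fieldType) (B : algType k)
    (H : left_bialgebroid B) := ComoduleAlgebra {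
  calg :> algType k;
  bar : {lrmorphism B^c -> calg};
  coact : {linear calg -> diamond (src H) bar};
  coact_barl : forall (b : B) p,
    coact (bar b * p) = tlift (coact p) (fun p0 p1 => p0 ⊗ (tgt H b * p1));
  coactA : forall p,
    tlift (coact p) (fun p0 p1 => coact p0 ⊗ p1 : diamond3 (src H) (tgt H) bar)
    = tlift (coact p) (fun p0 p1 =>
        tlift (comul H p1) (fun x1 x2 => (p0 ⊗ x1) ⊗ x2));
  coact_counit : forall p,
    tlift (coact p) (fun p0 p1 => bar (counit H p1) * p0) = p;
  coact_takeuchi : forall p, takeuchi (coact p);
  coact_bar : forall b : B, coact (bar b) = 1 ⊗ tgt H b;
  coactM : forall p q : calg, coact (p * q) = dmul (coact p) (coact q)
}.

Section RightAction.
Variables (k : fieldType) (B : algType k) (H : left_bialgebroid B).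
Variable P : comodule_algebra H.
Notation PH := (diamond (src H) (bar P)).
Notation f := (fun (b : B) (p : P) => bar P b * p).
Notation g := (fun (b : B) (x : H) => src H b * x).

(* Multiplication by \bar b on the right is the right action that the coaction
   defines on any right comodule. *)
Lemma comodule_ractE (b : B) (p : P) :
  p * bar P b =
  tlift (coact P p) (fun p0 p1 => bar P (counit H (p1 * src H b)) * p0).
Proof.
have cl (c : B) x : counit H (src H c * x) = c * counit H x.
  by have := counit_bimod c 1 x; rewrite rmorph1 !mulr1.
have [tl tr tb] := @tns_balanced k P H B f g.
have PsiB : balanced f g (fun p x => bar P (counit H x) * p).
  split=> [x c p1 p2|p1 c x y|c p1 x] /=.
  - by rewrite mulrDr scalerAr.
  - by rewrite !linearP mulrDl scalerAl.
  - by rewrite mulrA cl -(rmorphM (bar P)).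
have RB (c : P) (y : H) : balanced f g (fun p x => (p * c) ⊗ (x * y) : PH).
  split=> [x d p1 p2|p1 d x z|d p1 x] /=.
  - by rewrite mulrDl -scalerAl; exact: tl.
  - by rewrite mulrDl -scalerAl; exact: tr.
  - by rewrite -!mulrA; exact: tb.
have E : coact P (p * bar P b)
    = tlift (coact P p) (fun p0 p1 => p0 ⊗ (p1 * tgt H b)).
  rewrite coactM coact_bar /dmul tlift_tns.
    by apply: eq_tlift => m n; rewrite mulr1.
  split=> [y d c1 c2|c d y1 y2|d c y] /=.
  - rewrite -tliftZD; apply: eq_tlift => m n.
    by rewrite mulrDr -scalerAr; exact: tl.
  - rewrite -tliftZD; apply: eq_tlift => m n.
    by rewrite mulrDr -scalerAr; exact: tr.
  - have Q (phi : P -> H -> PH) :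
        tlift (tlift (coact P p) phi) (fun p x => (p * c) ⊗ (x * y) : PH)
        = tlift (coact P p)
            (fun m n => tlift (phi m n) (fun p x => (p * c) ⊗ (x * y) : PH)).
      exact: (linear_tlift _ _ (tlift_linear (RB c y))).
    have h := congr1 (fun z => tlift z (fun p x => (p * c) ⊗ (x * y) : PH))
      (coact_takeuchi p d).
    have TB := tlift_tns (RB c y).
    etransitivity; last first.
      etransitivity; first exact: (etrans (esym (Q _)) (etrans h (Q _))).
      by apply: eq_tlift => m n; rewrite TB mulrA.
    by apply: eq_tlift => m n; rewrite TB mulrA.
rewrite -[LHS]coact_counit E (linear_tlift _ _ (tlift_linear PsiB)).
apply: eq_tlift => m n; rewrite (tlift_tns PsiB).
have e : b = counit H (src H b) by rewrite -[src H b]mulr1 cl counit1 mulr1.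
by rewrite {1}e counit_tgt.
Qed.
End RightAction.

Section AntiCleft.
Variables (k : fieldType) (B : algType k) (H : hopf_algebroid B).
Variable P : comodule_algebra H.

Definition coinvariant (p : P) : Prop := coact P p = p ⊗ 1.

Definition reversible : Prop := bijective (can (coact P)).

Definition left_barlinear (r : H -> P) : Prop :=
  forall (b : B) x, r (tgt H b * x) = bar P b * r x.

Definition colinear (r : H -> P) : Prop :=
  left_barlinear r /\
  forall x, coact P (r x) = tlift (comul H x) (fun x1 x2 => r x1 ⊗ x2).

Definition anti_cleft (i : {lrmorphism B -> P}) : Prop :=
  [/\ reversible,
      injective i,
      forall b : B, coinvariant (i b)
    & exists rt : {linear H -> P},
      [/\ colinear rt,
          forall (b : B) x, rt (src H b * x) = i b * rt x
        & exists r : {linear H -> P},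
          [/\ left_barlinear r,
              forall (b : B) x, r (x * src H b) = r x * i b,
              forall x, tlift (translp x) (fun y z => rt y * r z)
                        = i (counit H x)
            & forall x, tlift (transrp x) (fun y z => r y * rt z)
                        = bar P (counit H x)]]].

Definition anti_cleft_extension : Prop :=
  exists i : {lrmorphism B -> P},
    anti_cleft i /\ forall p, coinvariant p -> exists b : B, i b = p.
End AntiCleft.

Section Cocycle.
Variables (k : fieldType) (B : algType k) (H : left_bialgebroid B).

(* \sum F X_1 X_2 Y_1 Y_2.  In all uses below F is balanced in X_1, X_2, and
   its sum over X_1, X_2 is balanced in Y_1, Y_2. *)
Definition sweedler2 (V : lmodType k) (x y : H) (F : H -> H -> H -> H -> V) : V :=
  tlift (comul H y) (fun y1 y2 =>
    tlift (comul H x) (fun x1 x2 => F x1 x2 y1 y2)).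

(* The product of {}_Gamma H. *)
Definition twist_mul (G : HtH H -> B) (x y : H) : H :=
  sweedler2 x y (fun x1 x2 y1 y2 => src H (G (x1 ⊗ y1)) * x2 * y2).

Record cocycle (G : HtH H -> B) : Prop := Cocycle {
  cocycle_bimod : forall (b c : B) x y,
    G ((src H b * tgt H c * x) ⊗ y) = b * G (x ⊗ y) * c;
  cocycleA : forall x y z,
    G (x ⊗ twist_mul G y z) = G (twist_mul G x y ⊗ z);
  cocycle1l : forall x, G (1 ⊗ x) = counit H x;
  cocycle1r : forall x, G (x ⊗ 1) = counit H x
}.

Record cocycle_inverse (G : HtH H -> B) (G' : HsH H -> B) : Prop :=
  CocycleInverse {
  cinv_bimod : forall (b c : B) x y,
    G' ((src H b * tgt H c * x) ⊗ y) = b * G' (x ⊗ y) * c;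
  cinv_tgt : forall (b : B) x y,
    G' (x ⊗ (tgt H b * y))
    = tlift (comul H x) (fun x1 x2 => (G' (x1 ⊗ y) * G' (x2 ⊗ tgt H b) : B));
  cinvr : forall x y,
    sweedler2 x y (fun x1 x2 y1 y2 => (G (x1 ⊗ y1) * G' (x2 ⊗ y2) : B))
    = G (x ⊗ src H (counit H y));
  cinvl : forall x y,
    sweedler2 x y (fun x1 x2 y1 y2 => (G' (x1 ⊗ y1) * G (x2 ⊗ y2) : B))
    = counit H (x * y)
}.

Definition invertible_cocycle (G : {linear HtH H -> B}) : Prop :=
  cocycle G /\ exists G' : {linear HsH H -> B}, cocycle_inverse G G'.

(* P is isomorphic to {}_Gamma H as a right H-comodule algebra. *)
Definition iso_twist (P : comodule_algebra H) (G : {linear HtH H -> B}) : Prop :=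
  exists phi : {linear H -> P},
    [/\ bijective phi,
        phi 1 = 1,
        forall x y, phi (twist_mul G x y) = phi x * phi y,
        forall b : B, phi (tgt H b) = bar P b
      & forall x, coact P (phi x)
                  = tlift (comul H x) (fun x1 x2 => phi x1 ⊗ x2)].
End Cocycle.

(* Main.v *)
(* Write X_+ (x) X_- and X_[+] (x) X_[-] for the translation maps of H, and
   p_+ (x) p_- for the preimage of p (x) 1 under the reversibility bijection of
   P.  Every identity between elements of iterated tensor products is tested
   against balanced maps, so that only sums over a single tensor occur.

   Given a cleaving (phi, r) of P, normalised by phi 1 = 1, the two conditions
   on r say that q (x) p |-> q_0 (x) phi(q_1) p is a bijection with inverse
   q (x) p |-> q_+ (x) r(q_-) p.  The element F(p) = p_+ r(p_-) is then
   coinvariant, so it lies in B, and p |-> F(p_0) p_1 is inverse to phi.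
   Transporting the product of P to H gives the cocycle
   Gamma(x, y) = eps(phi^-1(phi x phi y)), with inverse
   Gamma'(x, y) = eps(phi^-1(phi(x y_+) r(y_-))).

   Conversely, for P = {}_Gamma H take phi = id and
   r(x) = Gamma'(x_[+](1), x_[-]) x_[+](2).  Extended to H <> H through mu^-1,
   this formula is linear for the twisted product, which gives the first
   condition on r; the second one follows from
   Gamma'(x_1, y_1) (x_2 . y_2) = x y. *)

(* The obstacle is that [r] is only linear over B and over its opposite: no formula for its coaction
   is given, and H has no antipode, only the inverses of [lambda] and [mu]. So an expression in
   r(p_-) is not computed directly. It is recognised as a value of a map on a <>-product that is
   determined by its composite with a Galois map ([can], [lambda] or [mu]). Such a map is defined by
   composing with the inverse bijection, and its linearity rules come from equivariance of that
   inverse. The local maps [om], [om2], [th], [Om] and [nu] all arise in this way. The coaction of r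
   is avoided by inserting q_+(0) (x) phi(q_+(1)) r(q_-) = q (x) 1, after which it occurs unchanged
   on both sides. A second difficulty is that products of coactions are not balanced term by term.
   They become so after summing over the left factor, by the Takeuchi condition; hence the sum over
   the right factor is always the outer one. *)
Require Import Defs.
From HB Require Import structures.
From mathcomp Require Import all_boot all_order all_algebra.
From mathcomp Require Import boolp.

Set Implicit Arguments.
Unset Strict Implicit.
Unset Printing Implicit Defensive.

Import GRing.Theory.

Local Open Scope ring_scope.

(** * Linear maps and sums over tensors *)

(* Sealed copies of [tlift] and [tns]: unification would otherwise unfold them
   to sums over representatives. *)
HB.lock Definition tsum (k : fieldType) (M N : lmodType k) (I : Type)
    (f : I -> M -> M) (g : I -> N -> N) (V : lmodType k) (t : tensor f g)
    (phi : M -> N -> V) : V := tlift t phi.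
Arguments tsum {k M N I f g V} t phi.

HB.lock Definition ten (k : fieldType) (M N : lmodType k) (I : Type)
    (f : I -> M -> M) (g : I -> N -> N) (m : M) (n : N) : tensor f g := m ⊗ n.
Arguments ten {k M N I f g} m n.

Notation "m ⊠ n" := (ten m n) (at level 45, left associativity) : ring_scope.

Section LinearMaps.
Variables (k : fieldType) (U V W : lmodType k).

Lemma lin_id : linear (fun x : V => x).
Proof. by []. Qed.

Lemma lin_comp (g : V -> W) (f : U -> V) :
  linear g -> linear f -> linear (fun x => g (f x)).
Proof. by move=> hg hf a x y; rewrite hf hg. Qed.

Lemma lin_app (L : {linear V -> W}) (f : U -> V) :
  linear f -> linear (fun x => L (f x)).
Proof. exact/lin_comp/linearP. Qed.

Lemma lin_mulr (A : algType k) (c : A) (f : U -> A) :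
  linear f -> linear (fun x => f x * c).
Proof. by move=> hf a x y; rewrite hf mulrDl scalerAl. Qed.

Lemma lin_mull (A : algType k) (c : A) (f : U -> A) :
  linear f -> linear (fun x => c * f x).
Proof. by move=> hf a x y; rewrite hf mulrDr scalerAr. Qed.
End LinearMaps.

Section TensorCalculus.
Variables (k : fieldType) (M N : lmodType k) (I : Type).
Variables (f : I -> M -> M) (g : I -> N -> N).
Implicit Types U V W : lmodType k.

Lemma tsumE V (t : tensor f g) (phi : M -> N -> V) : tlift t phi = tsum t phi.
Proof. by rewrite unlock. Qed.

Lemma tenE m n : m ⊗ n = m ⊠ n :> tensor f g.
Proof. by rewrite unlock. Qed.

Lemma eq_tsum V (t : tensor f g) (phi psi : M -> N -> V) :
  (forall m n, phi m n = psi m n) -> tsum t phi = tsum t psi.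
Proof. by rewrite -!tsumE; apply: eq_tlift. Qed.

Lemma tsum_ten V (phi : M -> N -> V) m n :
  balanced f g phi -> tsum (m ⊠ n : tensor f g) phi = phi m n.
Proof. by move=> phiB; rewrite -tsumE -tenE tlift_tns. Qed.

Lemma ten_bal i m n : f i m ⊠ n = m ⊠ g i n :> tensor f g.
Proof. by rewrite -!tenE; have [_ _ ->] := tns_balanced f g. Qed.

Lemma lin_tenl U (h : U -> M) (n : N) :
  linear h -> linear (fun x => h x ⊠ n : tensor f g).
Proof.
have [tl _ _] := tns_balanced f g => hl a x y.
by rewrite -!tenE; apply: (lin_comp (tl n) hl).
Qed.

Lemma lin_tenr U (h : U -> N) (m : M) :
  linear h -> linear (fun x => m ⊠ h x : tensor f g).
Proof.
have [_ tr _] := tns_balanced f g => hl a x y.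
by rewrite -!tenE; apply: (lin_comp (tr m) hl).
Qed.

Lemma ten_balanced : balanced f g (fun m n => m ⊠ n : tensor f g).
Proof.
split=> [n|m|i m n]; last exact: ten_bal.
  by apply: lin_tenl; apply: lin_id.
by apply: lin_tenr; apply: lin_id.
Qed.

Lemma lin_tsum U V (phi : M -> N -> V) (h : U -> tensor f g) :
  balanced f g phi -> linear h -> linear (fun x => tsum (h x) phi).
Proof.
by move=> /tlift_linear pl hl a x y; rewrite -!tsumE; apply: (lin_comp pl hl).
Qed.

Lemma linear_tsum U V (L : U -> V) (t : tensor f g) phi :
  linear L -> L (tsum t phi) = tsum t (fun m n => L (phi m n)).
Proof. by rewrite -!tsumE; apply: linear_tlift. Qed.

(** The representative of [t] does not vary with the parameter, so [phi] need not be balanced; it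
    must be when the tensor itself varies, as in [lin_tsum]. *)
Lemma lin_tsum_fun U V (phi : U -> M -> N -> V) (t : tensor f g) :
  (forall m n, linear (fun x => phi x m n)) -> linear (fun x => tsum t (phi x)).
Proof.
by move=> h a x y; rewrite -!tsumE -tliftZD; apply: eq_tlift => m n; rewrite h.
Qed.

Lemma tensor_ext V (F G : tensor f g -> V) :
  linear F -> linear G -> (forall m n, F (m ⊠ n) = G (m ⊠ n)) -> F =1 G.
Proof.
move=> hF hG FG; elim/tensor_ind => [|m n t IH].
  have := hF (-1) 0 0; have := hG (-1) 0 0.
  by rewrite scaler0 addr0 !scaleN1r !addNr => -> ->.
have := hF 1 (m ⊠ n) t; have := hG 1 (m ⊠ n) t.
by rewrite tenE !scale1r FG IH => -> ->.
Qed.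

Lemma tsum_id (t : tensor f g) : tsum t (fun m n => m ⊠ n : tensor f g) = t.
Proof.
have tb := ten_balanced.
apply: (tensor_ext (F := fun t => tsum t _) (G := id)) t => // [|m n].
  by apply: (lin_tsum tb); apply: lin_id.
exact: tsum_ten.
Qed.

Lemma tsum_mulr (A : algType k) (t : tensor f g) (phi : M -> N -> A) c :
  tsum t phi * c = tsum t (fun m n => phi m n * c).
Proof.
by apply: (linear_tsum (L := fun x => x * c)); apply: lin_mulr; apply: lin_id.
Qed.

Lemma tsum_mull (A : algType k) (t : tensor f g) (phi : M -> N -> A) c :
  c * tsum t phi = tsum t (fun m n => c * phi m n).
Proof.
by apply: (linear_tsum (L := fun x => c * x)); apply: lin_mull; apply: lin_id.
Qed.

Lemma tsum_app V W (L : {linear V -> W}) (t : tensor f g) (phi : M -> N -> V) :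
  L (tsum t phi) = tsum t (fun m n => L (phi m n)).
Proof. exact/linear_tsum/linearP. Qed.
End TensorCalculus.

Section IteratedSums.
Variables (k : fieldType) (M N : lmodType k) (I : Type).
Variables (f : I -> M -> M) (g : I -> N -> N).
Variables (M' N' : lmodType k) (I' : Type).
Variables (f' : I' -> M' -> M') (g' : I' -> N' -> N').
Variable V : lmodType k.

Lemma tsum_tsum (t : tensor f g)
    (phi : M -> N -> tensor f' g') (psi : M' -> N' -> V) :
  balanced f' g' psi ->
  tsum (tsum t phi) psi = tsum t (fun m n => tsum (phi m n) psi).
Proof.
move=> psiB; apply: (linear_tsum (L := fun z => tsum z psi)).
by apply: (lin_tsum psiB); apply: lin_id.
Qed.

(** Both sides are finite sums over fixed representatives, so no balancedness enters and sums may be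
    reordered freely. *)
Lemma tsum_exchange (t : tensor f g) (t' : tensor f' g')
    (phi : M -> N -> M' -> N' -> V) :
  tsum t (fun m n => tsum t' (fun m' n' => phi m n m' n'))
  = tsum t' (fun m' n' => tsum t (fun m n => phi m n m' n')).
Proof.
rewrite !unlock /tlift; under eq_bigr do rewrite scaler_sumr.
rewrite exchange_big; apply: eq_bigr => p _ /=.
by rewrite scaler_sumr; apply: eq_bigr => q _; rewrite !scalerA mulrC.
Qed.

End IteratedSums.

(** A hook for [lin_step], redefined below to use linearity hypotheses from the context. *)
Ltac lin_user := fail.

(* Proves linearity by following the unique path to the bound variable. *)
Ltac lin_step :=
  first
    [ assumption
    | exact: lin_id
    | lin_user
    | apply: lin_mull
    | apply: lin_mulr
    | apply: lin_tenl
    | apply: lin_tenr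
    | apply: lin_tsum_fun => ? ?
    | apply: lin_tsum
    | apply: lin_app ].
Ltac lin := cbn beta; repeat (lin_step; cbn beta).
Ltac balance := split; [move=> ?; lin | move=> ?; lin | move=> ? ? ? /=].

(** * Comodule algebras *)

Section Counit.
Variables (k : fieldType) (B : algType k) (H : left_bialgebroid B).

Lemma counit_srcM (b : B) x : counit H (src H b * x) = b * counit H x.
Proof. by have := counit_bimod b 1 x; rewrite rmorph1 !mulr1. Qed.

Lemma counit_tgtM (b : B) x : counit H (tgt H b * x) = counit H x * b.
Proof. by have := counit_bimod 1 b x; rewrite rmorph1 !mul1r. Qed.

Lemma counit_srcE (b : B) : counit H (src H b) = b.
Proof. by rewrite -[src H b]mulr1 counit_srcM counit1 mulr1. Qed.

Lemma counit_tgtE (b : B) : counit H (tgt H b) = b.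
Proof. by rewrite -[tgt H b]mulr1 counit_tgtM counit1 mul1r. Qed.

Lemma comul_srcM (b : B) x :
  comul H (src H b * x) = tlift (comul H x) (fun x1 x2 => (src H b * x1) ⊗ x2).
Proof.
have := comul_bimod b 1 x; rewrite (rmorph1 (tgt H)) mulr1 => ->.
by apply: eq_tlift => x1 x2; rewrite mul1r.
Qed.

Lemma comul_tgtM (b : B) x :
  comul H (tgt H b * x) = tlift (comul H x) (fun x1 x2 => x1 ⊗ (tgt H b * x2)).
Proof.
have := comul_bimod 1 b x; rewrite rmorph1 mul1r => ->.
by apply: eq_tlift => x1 x2; rewrite mul1r.
Qed.

Lemma comul_tgt (b : B) : comul H (tgt H b) = 1 ⊗ tgt H b.
Proof.
rewrite -[tgt H b]mulr1 comul_tgtM comul1 tsumE.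
under eq_tsum do rewrite tenE.
rewrite !tenE tsum_ten //; balance.
by rewrite ten_bal !mulrA src_tgtC.
Qed.

(* Lemmas on comodule algebras specialise to the comultiplication of H. *)
Definition regular : comodule_algebra H :=
  ComoduleAlgebra (bar := tgt H) (coact := comul H) comul_tgtM (@comulA _ _ H)
    (@counitr _ _ H) (@comul_takeuchi _ _ H) comul_tgt (@comulM _ _ H).
End Counit.

Section Comodule.
Variables (k : fieldType) (B : algType k) (H : left_bialgebroid B).
Variable P : comodule_algebra H.
Implicit Types (V : lmodType k) (b : B).

Notation PH := (diamond (src H) (bar P)).
Notation f := (fun (b : B) (p : P) => bar P b * p).
Notation g := (fun (b : B) (x : H) => src H b * x).

Section Test.
Variables (V : lmodType k) (phi : P -> H -> V).
Hypothesis phiB : balanced f g phi.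

Let phil n : linear (phi^~ n). Proof. by have [] := phiB. Qed.
Let phir m : linear (phi m). Proof. by have [] := phiB. Qed.
Let phib b m n : phi (bar P b * m) n = phi m (src H b * n).
Proof. by have [_ _] := phiB. Qed.

Lemma tsum_coact_barl b (p : P) :
  tsum (coact P (bar P b * p)) phi
  = tsum (coact P p) (fun a x => phi a (tgt H b * x)).
Proof.
rewrite coact_barl tsumE tsum_tsum //.
by apply: eq_tsum => a x; rewrite tenE tsum_ten.
Qed.

Lemma tsum_takeuchi b (p : P) :
  tsum (coact P p) (fun a x => phi (a * bar P b) x)
  = tsum (coact P p) (fun a x => phi a (x * src H b)).
Proof.
have := congr1 (fun z => tsum z phi) (coact_takeuchi p b).
rewrite !tsumE !tsum_tsum // => e; etransitivity; [etransitivity; last exact: e|];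
  by apply: eq_tsum => a x; rewrite tenE tsum_ten.
Qed.

Lemma mul_test_balanced a0 x0 :
  balanced f g (fun a x => phi (a * a0) (x * x0)).
Proof.
split=> [x|a|b a x].
- by apply: (lin_comp (phil _)); lin.
- by apply: (lin_comp (phir _)); lin.
- by rewrite -!mulrA phib.
Qed.

End Test.

(** A single summand is not balanced in (p0, x0): moving \bar b across gives a' \bar b on the left
    and x' s(b) on the right, and these agree only after summation, by the Takeuchi condition for
    [p]. *)
Lemma tsum_coactM_balanced V (phi : P -> H -> V) (p : P) : balanced f g phi ->
  balanced f g (fun p0 x0 =>
    tsum (coact P p) (fun a x => phi (a * p0) (x * x0))).
Proof.
move=> phiB; have [pl pr pb] := phiB.
split=> [x|a|b a x].
- apply: lin_tsum_fun => m n; apply: (lin_comp (pl _)); lin.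
- apply: lin_tsum_fun => m n; apply: (lin_comp (pr _)); lin.
- have := tsum_takeuchi (mul_test_balanced phiB a x) b p => /=.
  under eq_tsum do rewrite -mulrA.
  by move=> ->; apply: eq_tsum => m n; rewrite mulrA.
Qed.

Lemma tsum_coactM V (phi : P -> H -> V) (p q : P) : balanced f g phi ->
  tsum (coact P (p * q)) phi
  = tsum (coact P q) (fun a x =>
      tsum (coact P p) (fun a' x' => phi (a' * a) (x' * x))).
Proof.
move=> phiB; rewrite coactM /dmul tsumE tsum_tsum //; apply: eq_tsum => c y.
rewrite tsumE tsum_tsum //.
by apply: eq_tsum => a x; rewrite tenE tsum_ten.
Qed.

Lemma tsum_coact_barr V (phi : P -> H -> V) (p : P) b : balanced f g phi ->
  tsum (coact P (p * bar P b)) phi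
  = tsum (coact P p) (fun a x => phi a (x * tgt H b)).
Proof.
move=> phiB; rewrite tsum_coactM // coact_bar tenE.
rewrite tsum_ten; last exact: tsum_coactM_balanced.
by apply: eq_tsum => a x; rewrite mulr1.
Qed.

Lemma tsum_coinvMl V (phi : P -> H -> V) (c p : P) : balanced f g phi ->
  coact P c = c ⊠ 1 ->
  tsum (coact P (c * p)) phi = tsum (coact P p) (fun a x => phi (c * a) x).
Proof.
move=> phiB cc; rewrite tsum_coactM // cc; apply: eq_tsum => a x.
rewrite tsum_ten ?mul1r //; exact: (mul_test_balanced phiB).
Qed.

Lemma tsum_coinvMr V (phi : P -> H -> V) (c p : P) : balanced f g phi ->
  coact P c = c ⊠ 1 ->
  tsum (coact P (p * c)) phi = tsum (coact P p) (fun a x => phi (a * c) x).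
Proof.
move=> phiB cc; rewrite tsum_coactM // cc.
rewrite tsum_ten; last exact: tsum_coactM_balanced.
by apply: eq_tsum => a x; rewrite mulr1.
Qed.

Lemma tsum_coact_counit (p : P) :
  tsum (coact P p) (fun a x => bar P (counit H x) * a) = p.
Proof. by rewrite -[RHS]coact_counit tsumE. Qed.

Lemma mulr_barE (p : P) b :
  p * bar P b
  = tsum (coact P p) (fun a x => bar P (counit H (x * src H b)) * a).
Proof. by rewrite comodule_ractE tsumE. Qed.

(** The right action of \bar b is given by the coaction, and for c (x) 1 that formula reduces to the
    left action. *)
Lemma coinvariant_barC (c : P) b :
  coact P c = c ⊠ 1 -> c * bar P b = bar P b * c.
Proof.
move=> cc; rewrite mulr_barE cc tsum_ten ?mul1r ?counit_srcE //; balance.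
by rewrite -mulrA counit_srcM mulrA -(rmorphM (bar P)).
Qed.

(** The hypotheses say that [chi] factors through P <> H <> H; the two iterated sums are the values
    of the induced map at the two sides of [coactA]. *)
Lemma coassoc V (chi : P -> H -> H -> V) (p : P) :
  (forall y z, linear (fun a => chi a y z)) ->
  (forall a z, linear (fun y => chi a y z)) ->
  (forall a y, linear (fun z => chi a y z)) ->
  (forall b a y z, chi (bar P b * a) y z = chi a (src H b * y) z) ->
  (forall b a y z, chi a (tgt H b * y) z = chi a y (src H b * z)) ->
  tsum (coact P p) (fun a x => tsum (coact P a) (fun a0 a1 => chi a0 a1 x))
  = tsum (coact P p) (fun a x => tsum (comul H x) (fun x1 x2 => chi a x1 x2)).
Proof.
move=> l1 l2 l3 b1 b2.
have cB x : balanced f g (fun a y => chi a y x) by split=> [y|a|b a y] /=.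
have cB3 : balanced
    (fun b (z : PH) => tlift z (fun a x => a ⊗ (tgt H b * x) : PH)) g
    (fun (w : PH) x => tsum w (fun a y => chi a y x)).
  split=> [x|w|b w x] /=.
  - by apply: lin_tsum => //; lin.
  - by apply: lin_tsum_fun => m n.
  - rewrite tsumE tsum_tsum //; apply: eq_tsum => a y.
    by rewrite tenE tsum_ten // b2.
have := congr1 (fun z => tsum z (fun (w : PH) x =>
   tsum w (fun a y => chi a y x))) (coactA p).
rewrite !tsumE !tsum_tsum // => e; etransitivity; [etransitivity; last exact: e|].
  by apply: eq_tsum => a x; rewrite tenE tsum_ten.
apply: eq_tsum => a x; rewrite tsumE tsum_tsum //; apply: eq_tsum => x1 x2.
by rewrite !tenE !tsum_ten.
Qed.
End Comodule.

Section Comultiplication.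
Variables (k : fieldType) (B : algType k) (H : left_bialgebroid B).
Implicit Types (V : lmodType k) (b : B) (x y : H).

Notation f := (fun (b : B) (x : H) => tgt H b * x).
Notation g := (fun (b : B) (x : H) => src H b * x).

Lemma comul_src b : comul H (src H b) = src H b ⊠ 1.
Proof.
rewrite -[src H b]mulr1 comul_srcM comul1 tsumE.
under eq_tsum do rewrite tenE.
rewrite !tenE tsum_ten ?mulr1 //; balance.
by rewrite -ten_bal !mulrA src_tgtC.
Qed.

Lemma tsum_counitl x : tsum (comul H x) (fun x1 x2 => src H (counit H x1) * x2) = x.
Proof. by rewrite -[RHS](counitl x) tsumE. Qed.

Lemma tsum_counitr x : tsum (comul H x) (fun x1 x2 => tgt H (counit H x2) * x1) = x.
Proof. by rewrite -[RHS](counitr x) tsumE. Qed.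

Section Test.
Variables (V : lmodType k) (phi : H -> H -> V).
Hypothesis phiB : balanced f g phi.

Lemma tsum_comul_srcl b x :
  tsum (comul H (src H b * x)) phi
  = tsum (comul H x) (fun x1 x2 => phi (src H b * x1) x2).
Proof. exact: (tsum_coinvMl (P := regular H) x phiB (comul_src b)). Qed.

Lemma tsum_comul_srcr b x :
  tsum (comul H (x * src H b)) phi
  = tsum (comul H x) (fun x1 x2 => phi (x1 * src H b) x2).
Proof. exact: (tsum_coinvMr (P := regular H) x phiB (comul_src b)). Qed.

Lemma tsum_comul_tgtl b x :
  tsum (comul H (tgt H b * x)) phi
  = tsum (comul H x) (fun x1 x2 => phi x1 (tgt H b * x2)).
Proof. exact: (tsum_coact_barl (P := regular H)). Qed.

Lemma tsum_comul_tgtr b x :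
  tsum (comul H (x * tgt H b)) phi
  = tsum (comul H x) (fun x1 x2 => phi x1 (x2 * tgt H b)).
Proof. exact: (tsum_coact_barr (P := regular H)). Qed.

Lemma tsum_comul_takeuchi b x :
  tsum (comul H x) (fun x1 x2 => phi (x1 * tgt H b) x2)
  = tsum (comul H x) (fun x1 x2 => phi x1 (x2 * src H b)).
Proof. exact: (tsum_takeuchi (P := regular H)). Qed.

Lemma tsum_comulM_balanced x :
  balanced f g (fun y1 y2 => tsum (comul H x) (fun x1 x2 => phi (x1 * y1) (x2 * y2))).
Proof. exact: (tsum_coactM_balanced (P := regular H)). Qed.

Lemma tsum_comulM x y :
  tsum (comul H (x * y)) phi
  = tsum (comul H y) (fun y1 y2 =>
      tsum (comul H x) (fun x1 x2 => phi (x1 * y1) (x2 * y2))).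
Proof. exact: (tsum_coactM (P := regular H)). Qed.
End Test.

Lemma coassocH V (chi : H -> H -> H -> V) x :
  (forall y z, linear (fun a => chi a y z)) ->
  (forall a z, linear (fun y => chi a y z)) ->
  (forall a y, linear (fun z => chi a y z)) ->
  (forall b a y z, chi (tgt H b * a) y z = chi a (src H b * y) z) ->
  (forall b a y z, chi a (tgt H b * y) z = chi a y (src H b * z)) ->
  tsum (comul H x) (fun x1 x2 => tsum (comul H x1) (fun x3 x4 => chi x3 x4 x2))
  = tsum (comul H x) (fun x1 x2 => tsum (comul H x2) (fun x3 x4 => chi x1 x3 x4)).
Proof. exact: (coassoc (P := regular H)). Qed.
End Comultiplication.

Lemma can_sumE (k : fieldType) (B : algType k) (H : left_bialgebroid B)
    (P : comodule_algebra H) z :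
  can (coact P) z
  = tsum z (fun a x => tsum (coact P a) (fun a0 a1 => a0 ⊠ (a1 * x))).
Proof.
rewrite /can tsumE; apply: eq_tsum => a x; rewrite tsumE.
by apply: eq_tsum => ? ?; rewrite tenE.
Qed.

Lemma mu_sumE (k : fieldType) (B : algType k) (H : left_bialgebroid B)
    (z : HsH H) :
  mu z = tsum z (fun x y => tsum (comul H x) (fun x1 x2 => (x1 * y) ⊠ x2)).
Proof.
rewrite /mu tsumE; apply: eq_tsum => a x; rewrite tsumE.
by apply: eq_tsum => ? ?; rewrite tenE.
Qed.

(** The source of all rules for moving B past a translation map: it suffices to check on pure
    tensors that the Galois map K intertwines two operations, and its inverse does so too. *)
Lemma inverse_equivariant (k : fieldType) (M N T : lmodType k) (I : Type)
    (f : I -> M -> M) (g : I -> N -> N) (K : tensor f g -> T)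
    (K' : T -> tensor f g) (h : M -> N -> tensor f g) (G : T -> T) :
  cancel K K' -> cancel K' K -> linear K -> linear G -> balanced f g h ->
  (forall m n, K (h m n) = G (K (m ⊠ n))) ->
  forall z, K' (G z) = tsum (K' z) h.
Proof.
move=> KK' K'K Kl Gl hB KG z; apply: (can_inj KK'); rewrite K'K.
rewrite -[z in LHS]K'K.
apply: (tensor_ext (F := fun w => G (K w)) (G := fun w => K (tsum w h)));
  last by move=> m n; rewrite tsum_ten // KG.
- exact: lin_comp.
- by apply: (lin_comp Kl); lin.
Qed.

Ltac lin_user ::=
  match goal with h : _ |- _ =>
    first [ apply: (lin_comp (h _)) | apply: (lin_comp (h _ _))
          | apply: (lin_comp h) ]
  end.

(** * Translation maps *)

Section Reversible.
Variables (k : fieldType) (B : algType k) (H : left_bialgebroid B).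
Variable P : comodule_algebra H.
Implicit Types (V : lmodType k) (b : B).

Notation PH := (diamond (src H) (bar P)).
Notation f := (fun (b : B) (p : P) => bar P b * p).
Notation g := (fun (b : B) (x : H) => src H b * x).
Notation f' := (fun (b : B) (p : P) => p * bar P b).
Notation g' := (fun (b : B) (x : H) => tgt H b * x).
Notation PtH := (balanced_tensor (bar P) (tgt H)).

Lemma testMr V (phi : P -> H -> V) (x : H) :
  balanced f g phi -> balanced f g (fun a y => phi a (y * x)).
Proof.
case=> pl pr pb; split=> [y|a|b a y]; lin.
by rewrite pb mulrA.
Qed.

Lemma can_balanced :
  balanced f' g' (fun a x => tsum (coact P a) (fun a0 a1 => a0 ⊠ (a1 * x)) : PH).
Proof.
have tB x : balanced f g (fun a y => a ⊠ (y * x) : PH).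
  exact/testMr/ten_balanced.
balance; first exact: tB.
by rewrite tsum_coact_barr //; apply: eq_tsum => ? ?; rewrite mulrA.
Qed.

Lemma can_lin : linear (can (coact P)).
Proof.
move=> c z w; rewrite !can_sumE; move: c z w.
by apply: (lin_tsum can_balanced); exact: lin_id.
Qed.

Lemma can_ten (a : P) (x : H) :
  can (coact P) (a ⊠ x) = tsum (coact P a) (fun a0 a1 => a0 ⊠ (a1 * x)).
Proof. by rewrite can_sumE tsum_ten //; exact: can_balanced. Qed.

Variable kap : PH -> PtH.
Hypothesis canK : cancel (can (coact P)) kap.
Hypothesis kapK : cancel kap (can (coact P)).

Lemma kap_lin : linear kap.
Proof.
move=> c z w; apply: (can_inj canK).
by rewrite kapK can_lin !kapK.
Qed.

(** The tested form of can (kap z) = z; for z = p (x) 1 it reads p_+(0) (x) p_+(1) p_- = p (x) 1. *)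
Lemma tsum_kap V (psi : P -> H -> V) z : balanced f g psi ->
  tsum (kap z) (fun a x => tsum (coact P a) (fun a0 a1 => psi a0 (a1 * x)))
  = tsum z psi.
Proof.
move=> psiB; rewrite -[z in RHS]kapK can_sumE tsum_tsum //.
apply: eq_tsum => a x; rewrite tsum_tsum //.
by apply: eq_tsum => a0 a1; rewrite tsum_ten.
Qed.

Lemma kap_can (a : P) (x : H) :
  kap (tsum (coact P a) (fun a0 a1 => a0 ⊠ (a1 * x))) = a ⊠ x.
Proof. by rewrite -can_ten canK. Qed.

Section Equivariance.
Variables (V : lmodType k) (chi : P -> H -> V).
Hypothesis chiB : balanced f' g' chi.

Let kap_equivariant (h : P -> H -> PtH) (G : PH -> PH) z :
  balanced f' g' h -> linear G ->
  (forall a x, can (coact P) (h a x)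
     = G (tsum (coact P a) (fun a0 a1 => a0 ⊠ (a1 * x)))) ->
  tsum (kap (G z)) chi = tsum (kap z) (fun a x => tsum (h a x) chi).
Proof.
move=> hB Gl hG; rewrite -tsum_tsum //; congr (tsum _ chi).
apply: (inverse_equivariant canK kapK can_lin Gl hB) => a x.
by rewrite hG can_ten.
Qed.

Lemma tsum_kap_mulr (a : P) (x y : H) :
  tsum (kap (a ⊠ (x * y))) chi = tsum (kap (a ⊠ x)) (fun a x => chi a (x * y)).
Proof.
have [_ _ tb] := ten_balanced f' g'.
have GB : balanced f g (fun a x => a ⊠ (x * y) : PH).
  exact/testMr/ten_balanced.
rewrite -(tsum_ten a x GB) (@kap_equivariant (fun a x => a ⊠ (x * y))
    (fun z => tsum z (fun a x => a ⊠ (x * y)))).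
- by apply: eq_tsum => c z; rewrite tsum_ten.
- by balance; rewrite ten_bal mulrA.
- by lin.
- move=> c z; rewrite can_ten tsum_tsum //; apply: eq_tsum => ? ?.
  by rewrite tsum_ten // mulrA.
Qed.

Lemma tsum_kap_tgt (a : P) b (x : H) :
  tsum (kap (a ⊠ (tgt H b * x))) chi
  = tsum (kap (a ⊠ x)) (fun a x => chi (bar P b * a) x).
Proof.
have GB : balanced f g (fun a x => a ⊠ (tgt H b * x) : PH).
  balance; by rewrite ten_bal !mulrA src_tgtC.
rewrite -(tsum_ten a x GB) (@kap_equivariant (fun a x => (bar P b * a) ⊠ x)
    (fun z => tsum z (fun a x => a ⊠ (tgt H b * x)))).
- by apply: eq_tsum => c z; rewrite tsum_ten.
- by balance; rewrite -ten_bal mulrA.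
- by lin.
- move=> c z; rewrite can_ten tsum_tsum // tsum_coact_barl; last first.
    exact/testMr/ten_balanced.
  by apply: eq_tsum => ? ?; rewrite tsum_ten // mulrA.
Qed.

(** Under [can], a factor s(b) in front of x lands behind a_1, and the Takeuchi condition moves it
    behind a_0 as \bar b. *)
Lemma tsum_kap_barr (a : P) b (x : H) :
  tsum (kap ((a * bar P b) ⊠ x)) chi
  = tsum (kap (a ⊠ x)) (fun a x => chi a (src H b * x)).
Proof.
have tB y : balanced f g (fun a x => a ⊠ (x * y) : PH).
  exact/testMr/ten_balanced.
have GB : balanced f g (fun a x => (a * bar P b) ⊠ x : PH).
  by balance; rewrite -mulrA ten_bal.
rewrite -(tsum_ten a x GB) (@kap_equivariant (fun a x => a ⊠ (src H b * x))
    (fun z => tsum z (fun a x => (a * bar P b) ⊠ x))).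
- by apply: eq_tsum => c z; rewrite tsum_ten.
- by balance; rewrite ten_bal !mulrA src_tgtC.
- by lin.
- move=> c z; rewrite can_ten tsum_tsum //.
  under [RHS]eq_tsum do rewrite tsum_ten //.
  by rewrite (tsum_takeuchi (tB z)); apply: eq_tsum => ? ?; rewrite mulrA.
Qed.

Lemma tsum_kap_coinvMl (c a : P) (x : H) : coact P c = c ⊠ 1 ->
  tsum (kap ((c * a) ⊠ x)) chi = tsum (kap (a ⊠ x)) (fun a x => chi (c * a) x).
Proof.
move=> cc.
have tB y : balanced f g (fun a x => a ⊠ (x * y) : PH).
  exact/testMr/ten_balanced.
have GB : balanced f g (fun a x => (c * a) ⊠ x : PH).
  by balance; rewrite mulrA coinvariant_barC // -mulrA ten_bal.
rewrite -(tsum_ten a x GB) (@kap_equivariant (fun a x => (c * a) ⊠ x)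
    (fun z => tsum z (fun a x => (c * a) ⊠ x))).
- by apply: eq_tsum => d z; rewrite tsum_ten.
- by balance; rewrite mulrA ten_bal.
- by lin.
- move=> d z; rewrite can_ten tsum_tsum // tsum_coinvMl //.
  by apply: eq_tsum => ? ?; rewrite tsum_ten.
Qed.

End Equivariance.
End Reversible.

Section Translation.
Variables (k : fieldType) (B : algType k) (H : hopf_algebroid B).
Implicit Types (V : lmodType k) (b : B).

Notation f := (fun (b : B) (x : H) => tgt H b * x).
Notation g := (fun (b : B) (x : H) => src H b * x).
Notation HH := (diamond (src H) (tgt H)).

Lemma lambda_inv_lin : linear (@lambda_inv k B H).
Proof. exact: (kap_lin (P := regular H) (@lambdaK k B H) (@lambda_invK k B H)). Qed.

Lemma lambda_invE (x y : H) :
  lambda_inv (tsum (comul H x) (fun x1 x2 => x1 ⊠ (x2 * y))) = x ⊠ y.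
Proof. exact: (kap_can (P := regular H) (@lambdaK k B H)). Qed.

Lemma lambda_inv1 : lambda_inv (1 ⊠ 1) = 1 ⊠ 1 :> HtH H.
Proof.
have := lambda_invE 1 1; rewrite comul1 tenE tsum_ten ?mulr1 //.
exact/(testMr (P := regular H))/ten_balanced.
Qed.

Lemma tsum_lambda_inv V (psi : H -> H -> V) (z : HH) : balanced f g psi ->
  tsum (lambda_inv z)
    (fun x y => tsum (comul H x) (fun x1 x2 => psi x1 (x2 * y)))
  = tsum z psi.
Proof. exact: (tsum_kap (P := regular H) (@lambda_invK k B H)). Qed.

(** Since [mu] multiplies y into the left factor it is not an instance of [can]; the facts on its
    inverse run parallel to those on [kap]. *)
Lemma mu_balanced :
  balanced (fun b (x : H) => x * src H b) g
    (fun x y => tsum (comul H x) (fun x1 x2 => (x1 * y) ⊠ x2) : HH).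
Proof.
have tB (y : H) : balanced f g (fun x1 x2 => (x1 * y) ⊠ x2 : HH).
  by balance; rewrite -mulrA ten_bal.
balance; first exact: tB.
by rewrite tsum_comul_srcr //; apply: eq_tsum => ? ?; rewrite mulrA.
Qed.

Lemma mu_lin : linear (@mu k B H).
Proof.
move=> c z w; rewrite !mu_sumE; move: c z w.
by apply: (lin_tsum mu_balanced); exact: lin_id.
Qed.

Lemma mu_ten (x y : H) :
  mu (x ⊠ y : HsH H) = tsum (comul H x) (fun x1 x2 => (x1 * y) ⊠ x2).
Proof. by rewrite mu_sumE tsum_ten //; exact: mu_balanced. Qed.

Lemma mu_inv_lin : linear (@mu_inv k B H).
Proof.
move=> c z w; apply: (can_inj (@muK k B H)).
have muK' := @mu_invK k B H.
rewrite (muK' (c *: z + w)); have := mu_lin c (mu_inv z) (mu_inv w).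
by rewrite (muK' z) (muK' w).
Qed.

Lemma mu_invE (x y : H) :
  mu_inv (tsum (comul H x) (fun x1 x2 => (x1 * y) ⊠ x2)) = x ⊠ y.
Proof. by rewrite -mu_ten; exact: muK. Qed.

Lemma mu_inv1 : mu_inv (1 ⊠ 1) = 1 ⊠ 1 :> HsH H.
Proof.
have := mu_invE 1 1; rewrite comul1 tenE tsum_ten ?mulr1 //; balance.
by rewrite -mulrA ten_bal.
Qed.

Lemma tsum_mu_inv V (psi : H -> H -> V) (z : HH) : balanced f g psi ->
  tsum (mu_inv z)
    (fun x y => tsum (comul H x) (fun x1 x2 => psi (x1 * y) x2))
  = tsum z psi.
Proof.
move=> psiB; rewrite -[z in RHS](@mu_invK k B H) mu_sumE tsum_tsum //.
apply: eq_tsum => a x; rewrite tsum_tsum //.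
by apply: eq_tsum => a0 a1; rewrite tsum_ten.
Qed.

Section Equivariance.
Variables (V : lmodType k) (chi : H -> H -> V).
Hypothesis chiB : balanced (fun b (x : H) => x * src H b) g chi.

Let mu_inv_equivariant (h : H -> H -> HsH H) (phi : H -> H -> HH) x y :
  balanced (fun b (x : H) => x * src H b) g h -> balanced f g phi ->
  (forall c z, mu (h c z)
     = tsum (comul H c) (fun c1 c2 => phi (c1 * z) c2)) ->
  tsum (mu_inv (phi x y)) chi
  = tsum (mu_inv (x ⊠ y)) (fun a x => tsum (h a x) chi).
Proof.
move=> hB phiB hG; rewrite -tsum_tsum // -(tsum_ten x y phiB).
congr (tsum _ chi).
apply: (inverse_equivariant (G := fun z => tsum z phi) (@muK k B H)
  (@mu_invK k B H) mu_lin _ hB) => [|c z]; first by lin.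
rewrite hG mu_ten tsum_tsum //; apply: eq_tsum => ? ?.
by rewrite tsum_ten.
Qed.

Lemma tsum_mu_inv_tgt b (x y : H) :
  tsum (mu_inv (x ⊠ (tgt H b * y))) chi
  = tsum (mu_inv (x ⊠ y)) (fun x y => chi (tgt H b * x) y).
Proof.
have GB : balanced f g (fun x y => x ⊠ (tgt H b * y) : HH).
  balance; by rewrite ten_bal !mulrA src_tgtC.
rewrite (@mu_inv_equivariant (fun x y => (tgt H b * x) ⊠ y) _ x y _ GB).
- by apply: eq_tsum => c z; rewrite tsum_ten.
- by balance; rewrite -ten_bal mulrA.
- move=> c z; rewrite mu_ten tsum_comul_tgtl //; balance.
  by rewrite -mulrA ten_bal.
Qed.

Lemma tsum_mu_inv_srcl b (x y : H) :
  tsum (mu_inv ((src H b * x) ⊠ y)) chi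
  = tsum (mu_inv (x ⊠ y)) (fun x y => chi (src H b * x) y).
Proof.
have GB : balanced f g (fun x y => (src H b * x) ⊠ y : HH).
  by balance; rewrite mulrA src_tgtC -mulrA ten_bal.
rewrite (@mu_inv_equivariant (fun x y => (src H b * x) ⊠ y) _ x y _ GB).
- by apply: eq_tsum => c z; rewrite tsum_ten.
- by balance; rewrite -ten_bal mulrA.
- move=> c z; rewrite mu_ten tsum_comul_srcl //; last first.
    by balance; rewrite -mulrA ten_bal.
  by apply: eq_tsum => ? ?; rewrite mulrA.
Qed.

(** By the Takeuchi condition, s(b) behind x_2 equals \bar b inserted between x_1 and y, which is
    where [mu] puts a left factor of y. *)
Lemma tsum_mu_inv_srcr b (x y : H) :
  tsum (mu_inv (x ⊠ (y * src H b))) chi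
  = tsum (mu_inv (x ⊠ y)) (fun x y => chi x (tgt H b * y)).
Proof.
have GB : balanced f g (fun x y => x ⊠ (y * src H b) : HH).
  by balance; rewrite ten_bal mulrA.
rewrite (@mu_inv_equivariant (fun x y => x ⊠ (tgt H b * y)) _ x y _ GB).
- by apply: eq_tsum => c z; rewrite tsum_ten.
- by balance; rewrite ten_bal !mulrA src_tgtC.
- move=> c z; rewrite mu_ten.
  have tB : balanced f g (fun x1 x2 => (x1 * z) ⊠ x2 : HH).
    by balance; rewrite -mulrA ten_bal.
  rewrite -(tsum_comul_takeuchi tB).
  by apply: eq_tsum => ? ?; rewrite mulrA.
Qed.
End Equivariance.
End Translation.

(** * Cleavings *)

Section Colinear.
Variables (k : fieldType) (B : algType k) (H : left_bialgebroid B).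
Variables (P : comodule_algebra H) (phi : {linear H -> P}).
Hypothesis phi_tgt : forall (b : B) x, phi (tgt H b * x) = bar P b * phi x.
Hypothesis phi_coact : forall x,
  coact P (phi x) = tsum (comul H x) (fun x1 x2 => phi x1 ⊠ x2).

Lemma tsum_coact_colinear (V : lmodType k) (psi : P -> H -> V) x :
  balanced (fun (b : B) (p : P) => bar P b * p)
    (fun (b : B) (x : H) => src H b * x) psi ->
  tsum (coact P (phi x)) psi = tsum (comul H x) (fun x1 x2 => psi (phi x1) x2).
Proof.
move=> psiB; rewrite phi_coact tsum_tsum //.
by apply: eq_tsum => x1 x2; rewrite tsum_ten.
Qed.

(** By [mulr_barE] the right action is made of the coaction and the left action, both of which [phi]
    respects. *)
Lemma colinear_mul_tgt (b : B) x : phi (x * tgt H b) = phi x * bar P b.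
Proof.
rewrite mulr_barE tsum_coact_colinear; last first.
  by balance; rewrite -!mulrA counit_srcM mulrA -(rmorphM (bar P)).
have -> : x * tgt H b = tsum (comul H x)
    (fun x1 x2 => tgt H (counit H (x2 * src H b)) * x1).
  exact: (mulr_barE (P := regular H)).
by rewrite tsum_app; apply: eq_tsum => x1 x2; rewrite phi_tgt.
Qed.
End Colinear.

Section Cleaving.
Variables (k : fieldType) (B : algType k) (H : hopf_algebroid B).
Variable P : comodule_algebra H.
Implicit Types (V : lmodType k) (b : B).

Notation f := (fun (b : B) (p : P) => bar P b * p).
Notation g := (fun (b : B) (x : H) => src H b * x).
Notation f' := (fun (b : B) (p : P) => p * bar P b).
Notation g' := (fun (b : B) (x : H) => tgt H b * x).
Notation PH := (diamond (src H) (bar P)).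
Notation PtH := (balanced_tensor (bar P) (tgt H)).

Variable kap : PH -> PtH.
Hypothesis canK : cancel (can (coact P)) kap.
Hypothesis kapK : cancel kap (can (coact P)).

Variable i : {lrmorphism B -> P}.
Hypothesis i_coinv : forall b, coact P (i b) = i b ⊠ 1.

Variables phi r : {linear H -> P}.
Hypothesis phi_tgt : forall b (x : H), phi (tgt H b * x) = bar P b * phi x.
Hypothesis phi_src : forall b (x : H), phi (src H b * x) = i b * phi x.
Hypothesis phi_coact : forall x : H,
  coact P (phi x) = tsum (comul H x) (fun x1 x2 => phi x1 ⊠ x2).
Hypothesis r_tgt : forall b (x : H), r (tgt H b * x) = bar P b * r x.
Hypothesis r_src : forall b (x : H), r (x * src H b) = r x * i b.
Hypothesis phi_r : forall x : H,
  tsum (lambda_inv (x ⊠ 1)) (fun y z : H => phi y * r z) = i (counit H x).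
Hypothesis r_phi : forall x : H,
  tsum (mu_inv (1 ⊠ x)) (fun y z : H => r y * phi z) = bar P (counit H x).

Let kapl : linear kap := kap_lin canK kapK.
Let laml := @lambda_inv_lin k B H.
Let mui := @mu_inv_lin k B H.
Let iC (b c : B) : i b * bar P c = bar P c * i b := coinvariant_barC c (i_coinv b).

Let phir_balanced : balanced (fun b (x : H) => x * tgt H b)
  (fun b (x : H) => tgt H b * x) (fun y z : H => phi y * r z).
Proof. by balance; rewrite (colinear_mul_tgt phi_tgt phi_coact) r_tgt mulrA. Qed.

Let rphi_balanced : balanced (fun b (x : H) => x * src H b)
  (fun b (x : H) => src H b * x) (fun y z : H => r y * phi z).
Proof. by balance; rewrite r_src phi_src mulrA. Qed.

(** The map v_1 (x) v_2 w |-> phi(v) r(w) on H <> H; the first cleaving condition gives its value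
    i(eps(v)) at v (x) 1. *)
Let om (v w : H) : P := tsum (lambda_inv (v ⊠ w)) (fun y z : H => phi y * r z).

Let oml w : linear (om^~ w). Proof. by rewrite /om; lin. Qed.
Let omr v : linear (om v). Proof. by rewrite /om; lin. Qed.
Let omb b v w : om (tgt H b * v) w = om v (src H b * w).
Proof. by rewrite /om ten_bal. Qed.
Let omE v w : tsum (comul H v) (fun v1 v2 => om v1 (v2 * w)) = phi v * r w.
Proof.
rewrite -(tsum_ten _ _ phir_balanced) -lambda_invE.
by rewrite -(linear_tsum (L := fun z => tsum (lambda_inv z) _)) //; lin.
Qed.

Let oms b v w : om (src H b * v) w = i b * om v w.
Proof.
rewrite /om (tsum_kap_coinvMl (P := regular H) (@lambdaK k B H)
  (@lambda_invK k B H) phir_balanced _ _ (comul_src H b)).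
by rewrite tsum_mull; apply: eq_tsum => y z; rewrite phi_src mulrA.
Qed.

(* q_+(0) (x) phi(q_+(1)) r(q_-) = q (x) 1 in P <>_B P. *)
Lemma tsum_kap_cleft V (M : P -> P -> V) q :
  (forall p, linear (M^~ p)) -> (forall p, linear (M p)) ->
  (forall b u p, M (bar P b * u) p = M u (i b * p)) ->
  tsum (kap (q ⊠ 1))
    (fun a x => tsum (coact P a) (fun a0 a1 => M a0 (phi a1 * r x)))
  = M q 1.
Proof.
move=> Ml Mr Mb.
have chiB x : balanced f g (fun a0 a1 => M a0 (om a1 x)).
  by balance; rewrite Mb oms.
have psiB : balanced f g
    (fun a x => tsum (coact P a) (fun a0 a1 => M a0 (om a1 x))).
  balance; first exact: chiB.
  by rewrite tsum_coact_barl //; apply: eq_tsum => ? ?; rewrite omb.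
(* Writing phi(a_1) r(x) = om(a_1, a_2 x) and using coassociativity produces a function of a_0 and
   a_1 x, to which [tsum_kap] applies. *)
transitivity (tsum (kap (q ⊠ 1)) (fun a x => tsum (coact P a) (fun a0 a1 =>
    tsum (coact P a0) (fun a2 a3 => M a2 (om a3 (a1 * x)))))).
  apply: eq_tsum => a x; rewrite coassoc.
  - apply: eq_tsum => a0 a1; rewrite -(linear_tsum (L := M a0)) //.
    by rewrite omE.
  - by move=> y z; lin.
  - by move=> y z; lin.
  - by move=> y z; lin.
  - by move=> b c y z; rewrite Mb oms.
  - by move=> b c y z; rewrite omb mulrA.
rewrite (tsum_kap kapK _ psiB) tsum_ten //.
under eq_tsum do rewrite /om phi_r -[i _]mulr1 -Mb.
by rewrite -(linear_tsum (L := M^~ 1)) // tsum_coact_counit.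
Qed.

(** The map v_1 w (x) v_2 |-> r(v) phi(w) on H <> H; the second cleaving condition gives its value
    at 1 (x) x. *)
Let om2 (x y : H) : P := tsum (mu_inv (x ⊠ y)) (fun y z : H => r y * phi z).

Let om2l w : linear (om2^~ w). Proof. by rewrite /om2; lin. Qed.
Let om2r v : linear (om2 v). Proof. by rewrite /om2; lin. Qed.
Let om2b b v w : om2 (tgt H b * v) w = om2 v (src H b * w).
Proof. by rewrite /om2 ten_bal. Qed.
Let om2E v w : tsum (comul H v) (fun v1 v2 => om2 (v1 * w) v2) = r v * phi w.
Proof.
rewrite -(tsum_ten _ _ rphi_balanced) -mu_invE.
by rewrite -(linear_tsum (L := fun z => tsum (mu_inv z) _)) //; lin.
Qed.
Let om2t b v w : om2 v (tgt H b * w) = bar P b * om2 v w.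
Proof.
rewrite /om2 (tsum_mu_inv_tgt rphi_balanced) tsum_mull.
by apply: eq_tsum => y z; rewrite r_tgt mulrA.
Qed.

Section Twist.
Variable L : P -> P.
Hypothesis Ll : linear L.
Hypothesis Lb : forall b u, L (u * bar P b) = L u * bar P b.

(** For L = id this is F(q). For L(u) = phi(x psi(u)) its value at q = phi(y) is phi(x y_+)
    r(y_-). *)
Definition translate q : P := tsum (kap (q ⊠ 1)) (fun a x => L a * r x).

(** Two successive inversions of the Galois map: [Om] is the map on P <> H <> H with Om(q_0 (x) q_1
    x, q_2 y) = L(q) om2(x, y). *)
Let th (z : PH) (x : H) : P := tsum (kap z) (fun p y => L p * om2 x y).
Let Om (z : PH) (y : H) : P := tsum (kap z) (fun p x => th (p ⊠ y) x).

Let thB x : balanced f' g' (fun p y => L p * om2 x y).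
Proof. by balance; rewrite om2t Lb mulrA. Qed.

Let thl x : linear (th^~ x). Proof. by have := thB x; rewrite /th => hB; lin. Qed.
Let thr z : linear (th z). Proof. by rewrite /th; lin. Qed.

Let OmB y : balanced f' g' (fun p x => th (p ⊠ y) x).
Proof.
balance; rewrite /th (tsum_kap_barr canK kapK (thB _)).
by apply: eq_tsum => p z; rewrite om2b.
Qed.

Let Oml y : linear (Om^~ y). Proof. by have := OmB y; rewrite /Om => hB; lin. Qed.
Let Omr z : linear (Om z). Proof. by rewrite /Om; lin. Qed.

Let th_can q x y :
  tsum (coact P q) (fun a0 a1 => th (a0 ⊠ (a1 * y)) x) = L q * om2 x y.
Proof.
rewrite -(linear_tsum (L := th^~ x)) // /th kap_can //.
by rewrite tsum_ten //; exact: thB.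
Qed.

Let Om_can q x y :
  tsum (coact P q) (fun a0 a1 => Om (a0 ⊠ (a1 * x)) y) = th (q ⊠ y) x.
Proof.
rewrite -(linear_tsum (L := Om^~ y)) // /Om kap_can //.
by rewrite tsum_ten //; exact: OmB.
Qed.

Let Omb b p x y : Om (p ⊠ (tgt H b * x)) y = Om (p ⊠ x) (src H b * y).
Proof.
rewrite /Om (tsum_kap_tgt canK kapK (OmB _)).
by apply: eq_tsum => a z; rewrite ten_bal.
Qed.

Let psi1 (z : H) (a : P) (x : H) : P :=
  tsum (comul H x) (fun x1 x2 => Om (a ⊠ (x1 * z)) x2).

Let psi1_inner z a :
  balanced (fun b (x : H) => tgt H b * x) g (fun x1 x2 => Om (a ⊠ (x1 * z)) x2).
Proof. by balance; rewrite -mulrA Omb. Qed.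

Let psi1B z : balanced f g (psi1 z).
Proof.
rewrite /psi1; balance; first exact: psi1_inner.
rewrite (tsum_comul_srcl (psi1_inner z _)); apply: eq_tsum => x1 x2.
by rewrite ten_bal mulrA.
Qed.

Let psi1_coact q x z :
  tsum (coact P q) (fun a0 a1 => psi1 z a0 (a1 * x)) = L q * (r x * phi z).
Proof.
under eq_tsum do rewrite /psi1 (tsum_comulM (psi1_inner z _)).
rewrite tsum_exchange -om2E tsum_mull; apply: eq_tsum => x1 x2.
rewrite -(@coassoc _ _ _ _ _
  (fun a y w => Om (a ⊠ (y * x1 * z)) (w * x2))).
- rewrite -th_can; apply: eq_tsum => a0 a1; rewrite -Om_can.
  by apply: eq_tsum => a2 a3; rewrite mulrA.
- by move=> ? ?; lin.
- by move=> ? ?; lin.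
- by move=> ? ?; lin.
- by move=> b a y w; rewrite ten_bal !mulrA.
- by move=> b a y w; rewrite -!mulrA Omb.
Qed.

(** Since psi1 z sends q_0, q_1 x to L(q) r(x) phi(z), the sum over p_+ (x) p_- of the latter is
    psi1 z evaluated at (p, 1). *)
Let translate_phi p z : translate p * phi z = Om (p ⊠ z) 1.
Proof.
rewrite /translate tsum_mulr.
under eq_tsum do rewrite -mulrA -psi1_coact.
rewrite (tsum_kap kapK) // tsum_ten // /psi1 comul1 tenE.
by rewrite tsum_ten ?mul1r //; exact: psi1_inner.
Qed.

Let psi2B : balanced f g (fun a x => Om (coact P a) x).
Proof.
balance.
rewrite -[in LHS](tsum_id (coact P _)) (linear_tsum (L := Om^~ _)) //.
rewrite tsum_coact_barl; last by balance; rewrite ten_bal.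
under eq_tsum do rewrite Omb.
by rewrite -(linear_tsum (L := Om^~ _)) // tsum_id.
Qed.

(* q_0+ r(q_0-) phi(q_1) = q_+ r(q_-[+]) phi(q_-[-]) = q_+ eps(q_-) = q, for
   L = id. *)
Lemma tsum_translate p :
  tsum (coact P p) (fun a x => translate a * phi x) = L p.
Proof.
under eq_tsum do rewrite translate_phi.
rewrite -(linear_tsum (L := Om^~ 1)) // tsum_id.
have epsB : balanced f g (fun a x => bar P (counit H x) * a).
  by balance; rewrite counit_srcM mulrA -(rmorphM (bar P)).
have e : bar P (counit H 1) * p = p.
  by rewrite counit1 (rmorph1 (bar P)) mul1r.
rewrite -(tsum_ten p 1 psi2B) -(tsum_kap kapK _ psi2B).
rewrite -[in RHS]e -(tsum_ten p 1 epsB) -(tsum_kap kapK _ epsB) linear_tsum //.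
apply: eq_tsum => a x.
transitivity (L a * om2 1 x).
  rewrite -th_can; apply: eq_tsum => a0 a1; rewrite -Om_can.
  rewrite -[in LHS](tsum_id (coact P a0)) (linear_tsum (L := Om^~ _)) //.
  by apply: eq_tsum => a2 a3; rewrite mulr1.
rewrite /om2 r_phi -Lb mulr_barE; congr L; apply: eq_tsum => a0 a1.
by rewrite counit_src.
Qed.

Let LrB : balanced f' g' (fun a x => L a * r x).
Proof. by balance; rewrite Lb r_tgt mulrA. Qed.

Lemma translate_lin : linear translate.
Proof. by rewrite /translate; lin; exact: LrB. Qed.

(** In P <> H, \bar b q (x) 1 = q (x) s(b), and s(b) ends up behind q_-, where [r] turns it into
    i(b). *)
Lemma translate_barl b q : translate (bar P b * q) = translate q * i b.
Proof.
rewrite /translate ten_bal mulr1 -[src H b]mul1r.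
rewrite (tsum_kap_mulr canK kapK LrB) tsum_mulr.
by apply: eq_tsum => a x; rewrite r_src mulrA.
Qed.

(** There is no rule for r(x) \bar b. Instead [tsum_kap_cleft] rewrites the product as a sum of
    translate(q_+(0)) \bar b phi(q_+(1)) r(q_-); here \bar b is absorbed by phi, and hence by q_+,
    and [tsum_translate] removes phi. *)
Lemma translate_barr b q :
  translate q * bar P b = tsum (kap (q ⊠ 1)) (fun a x => L (bar P b * a) * r x).
Proof.
have tl := translate_lin.
rewrite -[bar P b]mulr1.
rewrite -(@tsum_kap_cleft _ (fun u p => translate u * (bar P b * p))).
- apply: eq_tsum => a x; rewrite mulr1 -tsum_translate.
  rewrite tsum_coact_barl; last by balance; rewrite translate_barl phi_src mulrA.
  by rewrite tsum_mulr; apply: eq_tsum => ? ?; rewrite phi_tgt !mulrA.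
- by move=> p; lin.
- by move=> p; lin.
- by move=> c u p; rewrite translate_barl -mulrA [i c * _]mulrA iC !mulrA.
Qed.

End Twist.

(* Two instances are used: Q = P with w = 1 and L m u = m * u, and Q = H with
   L m u = phi (m * psi u). *)
Section Family.
Variables (Q : comodule_algebra H) (L : Q -> P -> P).
Hypothesis Ll : forall m, linear (L m).
Hypothesis Lr : forall u, linear (L^~ u).
Hypothesis Lb : forall b m u, L m (u * bar P b) = L m u * bar P b.
Hypothesis Lbarl : forall b m u, L (bar Q b * m) u = bar P b * L m u.
Hypothesis Lbarr : forall b m u, L (m * bar Q b) u = L m (bar P b * u).
Variable w : Q.
Hypothesis L_coact : forall u, coact P (L w u)
  = tsum (coact Q w) (fun m y =>
      tsum (coact P u) (fun u0 u1 => L m u0 ⊠ (y * u1))).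

Let N m q := translate (L m) q.

Let Nl m : linear (N m). Proof. exact: translate_lin (Ll m) (fun b => Lb b m). Qed.
Let Nr q : linear (N^~ q). Proof. by rewrite /N /translate; lin. Qed.
Let Nbarl b m q : N (bar Q b * m) q = bar P b * N m q.
Proof.
by rewrite /N /translate tsum_mull; apply: eq_tsum => a x; rewrite Lbarl mulrA.
Qed.
Let Nbarr b m q : N (m * bar Q b) q = N m q * bar P b.
Proof.
rewrite /N (translate_barr (Ll m) (fun b => Lb b m)).
by apply: eq_tsum => a x; rewrite Lbarr.
Qed.

Let W (u c : P) (z : H) : PH :=
  tsum (coact Q w) (fun m y => (N m u * c) ⊠ (y * z)).

Let W_test u c z : balanced (fun b (m : Q) => bar Q b * m) g
  (fun m y => (N m u * c) ⊠ (y * z) : PH).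
Proof. by balance; rewrite Nbarl -!mulrA ten_bal. Qed.

Let Wl c z : linear (fun u => W u c z). Proof. by rewrite /W; lin. Qed.

Let W_barl b u c z : W u (bar P b * c) z = W u c (src H b * z).
Proof.
rewrite /W; under eq_tsum do rewrite mulrA -Nbarr.
rewrite (tsum_takeuchi (W_test u c z)).
by apply: eq_tsum => m y; rewrite mulrA.
Qed.

Let WB u : balanced f g (W u).
Proof. by rewrite /W; balance; exact: W_barl. Qed.

(** With N_m = translate (L m) and M(u, p) = N_{w_0}(u) p_0 (x) w_1 p_1, the right side is M(q, 1).
    [tsum_kap_cleft] makes it the sum of M(q_+(0), phi(q_+(1)) r(q_-)). Colinearity of phi and
    [tsum_translate] then turn N back into L, leaving the product of the coactions of L_w(q_+) and
    r(q_-). *)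
Lemma coact_translate q :
  coact P (translate (L w) q)
  = tsum (coact Q w) (fun m y => translate (L m) q ⊠ y).
Proof.
pose M u p := tsum (coact P p) (W u).
have -> : tsum (coact Q w) (fun m y => N m q ⊠ y) = M q 1.
  rewrite /M -(rmorph1 (bar P)) coact_bar tenE tsum_ten //.
  by apply: eq_tsum => m y; rewrite mulr1 (rmorph1 (tgt H)) mulr1.
rewrite -(@tsum_kap_cleft _ M); first last.
- move=> b u p; rewrite /M tsum_coinvMl //; apply: eq_tsum => c z.
  by apply: eq_tsum => m y; rewrite /N translate_barl // mulrA.
- by move=> u; rewrite /M; lin.
- by move=> p; rewrite /M; lin.
rewrite {1}/translate tsum_app; apply: eq_tsum => a x.
rewrite -[LHS]tsum_id tsum_coactM; last exact: ten_balanced.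
under [RHS]eq_tsum do rewrite /M tsum_coactM //.
rewrite [RHS]tsum_exchange; apply: eq_tsum => c z.
have tB : balanced f g (fun a' x' => (a' * c) ⊠ (x' * z) : PH).
  exact: (mul_test_balanced (ten_balanced _ _)).
rewrite L_coact tsum_tsum //.
under eq_tsum do (rewrite tsum_tsum //; under eq_tsum do rewrite tsum_ten //).
have cB u : balanced f g (fun c' z' => W u (c' * c) (z' * z)).
  exact: (mul_test_balanced (WB u)).
under [RHS]eq_tsum do rewrite (tsum_coact_colinear phi_coact _ (cB _)).
rewrite -(@coassoc _ _ _ _ _ (fun v y z' => W v (phi y * c) (z' * z))).
- rewrite /W; under [RHS]eq_tsum do rewrite tsum_exchange.
  rewrite [RHS]tsum_exchange; apply: eq_tsum => m y; apply: eq_tsum => a0 a1.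
  rewrite -(tsum_translate (Ll m) (fun b => Lb b m)) tsum_mulr.
  rewrite (linear_tsum (L := fun p => p ⊠ _)); last by lin.
  by apply: eq_tsum => ? ?; rewrite !mulrA.
- by move=> ? ?; lin.
- by move=> v ?; have [Wl' Wr' _] := WB v; lin.
- by move=> v ?; have [Wl' Wr' _] := WB v; lin.
- move=> b v y z'; rewrite /W; apply: eq_tsum => m x'.
  by rewrite /N translate_barl // phi_src !mulrA.
- by move=> b v y z'; rewrite phi_tgt -!mulrA W_barl.
Qed.

End Family.

End Cleaving.

Lemma linear_pack (k : fieldType) (U V : lmodType k) (f : U -> V) :
  linear f -> exists L : {linear U -> V}, forall x, L x = f x.
Proof.
move=> fl; pose m := GRing.isLinear.Build k U V *:%R f fl.
by exists (HB.pack_for {linear U -> V} f m).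
Qed.

Lemma sweedler2E (k : fieldType) (B : algType k) (H : left_bialgebroid B)
    (V : lmodType k) (x y : H) (F : H -> H -> H -> H -> V) :
  sweedler2 x y F = tsum (comul H y) (fun y1 y2 =>
    tsum (comul H x) (fun x1 x2 => F x1 x2 y1 y2)).
Proof. by rewrite /sweedler2 tsumE; apply: eq_tsum => ? ?; rewrite tsumE. Qed.

(** * Colinear bijections from H to a comodule algebra *)

Section Trivialization.
Variables (k : fieldType) (B : algType k) (H : left_bialgebroid B).
Variable P : comodule_algebra H.
Implicit Types (V : lmodType k) (b : B).

Notation f := (fun (b : B) (p : P) => bar P b * p).
Notation g := (fun (b : B) (x : H) => src H b * x).

Variable i : {lrmorphism B -> P}.
Variables (phi : {linear H -> P}) (psi : {linear P -> H}).
Hypothesis phiK : cancel phi psi.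
Hypothesis psiK : cancel psi phi.
Hypothesis phi1 : phi 1 = 1.
Hypothesis phi_tgt : forall b (x : H), phi (tgt H b * x) = bar P b * phi x.
Hypothesis phi_src : forall b (x : H), phi (src H b * x) = i b * phi x.
Hypothesis phi_coact : forall x : H,
  coact P (phi x) = tsum (comul H x) (fun x1 x2 => phi x1 ⊠ x2).

Lemma phi_srcE b : phi (src H b) = i b.
Proof. by rewrite -[src H b]mulr1 phi_src phi1 mulr1. Qed.

Lemma phi_tgtE b : phi (tgt H b) = bar P b.
Proof. by rewrite -[tgt H b]mulr1 phi_tgt phi1 mulr1. Qed.

Lemma psi_srcM b p : psi (i b * p) = src H b * psi p.
Proof. by apply: (can_inj phiK); rewrite phi_src !psiK. Qed.

Lemma psi_tgtM b p : psi (bar P b * p) = tgt H b * psi p.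
Proof. by apply: (can_inj phiK); rewrite phi_tgt !psiK. Qed.

Lemma psi_mul_tgt b p : psi (p * bar P b) = psi p * tgt H b.
Proof.
by apply: (can_inj phiK); rewrite (colinear_mul_tgt phi_tgt phi_coact) !psiK.
Qed.

(** The counit carried to P; on phi(x) phi(y) it is the cocycle. *)
Definition trace (p : P) : B := counit H (psi p).

Lemma trace_lin : linear trace.
Proof. by rewrite /trace; lin. Qed.

Lemma trace_srcM b p : trace (i b * p) = b * trace p.
Proof. by rewrite /trace psi_srcM counit_srcM. Qed.

Lemma trace_tgtM b p : trace (bar P b * p) = trace p * b.
Proof. by rewrite /trace psi_tgtM counit_tgtM. Qed.

Lemma trace_src b : trace (i b) = b.
Proof. by rewrite -phi_srcE /trace phiK counit_srcE. Qed.

Lemma trace_phi x : trace (phi x) = counit H x.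
Proof. by rewrite /trace phiK. Qed.

Lemma trace_test_balanced : balanced f g (fun a x => i (trace a) * phi x).
Proof.
have tl := trace_lin; balance.
by rewrite trace_tgtM phi_src mulrA -(rmorphM i).
Qed.

(** The left counit law of H, transported by [phi]: an element is recovered from the traces in its
    coaction. *)
Lemma tsum_trace p : tsum (coact P p) (fun a x => i (trace a) * phi x) = p.
Proof.
rewrite -[p in LHS]psiK (tsum_coact_colinear phi_coact _ trace_test_balanced).
rewrite -[in RHS](psiK p) -[in RHS](tsum_counitl (psi p)) tsum_app.
by apply: eq_tsum => x1 x2; rewrite trace_phi phi_src.
Qed.

(** This exhibits the transported product as the twisted product for Gamma(x, y) = trace(phi(x)
    phi(y)). *)
Lemma tsum_trace_mul (x y : H) : phi x * phi y
  = tsum (comul H y) (fun y1 y2 => tsum (comul H x) (fun x1 x2 =>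
      i (trace (phi x1 * phi y1)) * phi (x2 * y2))).
Proof.
have tB := trace_test_balanced.
rewrite -[LHS]tsum_trace (tsum_coactM _ _ tB).
rewrite (tsum_coact_colinear phi_coact); last first.
  exact: (tsum_coactM_balanced (phi x) tB).
apply: eq_tsum => y1 y2; rewrite (tsum_coact_colinear phi_coact) //.
exact: (mul_test_balanced tB).
Qed.

End Trivialization.

(** * The cocycle of a cleaving *)

Section CleftCocycle.
Variables (k : fieldType) (B : algType k) (H : hopf_algebroid B).
Variable P : comodule_algebra H.
Implicit Types (V : lmodType k) (b : B).

Notation f := (fun (b : B) (p : P) => bar P b * p).
Notation g := (fun (b : B) (x : H) => src H b * x).
Notation f' := (fun (b : B) (p : P) => p * bar P b).
Notation g' := (fun (b : B) (x : H) => tgt H b * x).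
Notation PH := (diamond (src H) (bar P)).
Notation PtH := (balanced_tensor (bar P) (tgt H)).

Variable kap : PH -> PtH.
Hypothesis canK : cancel (can (coact P)) kap.
Hypothesis kapK : cancel kap (can (coact P)).

Variable i : {lrmorphism B -> P}.
Hypothesis i_coinv : forall b, coact P (i b) = i b ⊠ 1.

Variables phi r : {linear H -> P}.
Hypothesis phi1 : phi 1 = 1.
Hypothesis phi_tgt : forall b (x : H), phi (tgt H b * x) = bar P b * phi x.
Hypothesis phi_src : forall b (x : H), phi (src H b * x) = i b * phi x.
Hypothesis phi_coact : forall x : H,
  coact P (phi x) = tsum (comul H x) (fun x1 x2 => phi x1 ⊠ x2).
Hypothesis r_tgt : forall b (x : H), r (tgt H b * x) = bar P b * r x.
Hypothesis r_src : forall b (x : H), r (x * src H b) = r x * i b.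
Hypothesis phi_r : forall x : H,
  tsum (lambda_inv (x ⊠ 1)) (fun y z : H => phi y * r z) = i (counit H x).
Hypothesis r_phi : forall x : H,
  tsum (mu_inv (1 ⊠ x)) (fun y z : H => r y * phi z) = bar P (counit H x).

Let kapl : linear kap := kap_lin canK kapK.
Let laml := @lambda_inv_lin k B H.

Let iM (b c : B) : i (b * c) = i b * i c := rmorphM i b c.

(** A colinear map intertwines [lambda] and [can], so phi(x)_+ (x) phi(x)_- = phi(x_+) (x) x_-. *)
Lemma tsum_kap_colinear V (chi : P -> H -> V) (x : H) : balanced f' g' chi ->
  tsum (kap (phi x ⊠ 1)) chi
  = tsum (lambda_inv (x ⊠ 1)) (fun y z : H => chi (phi y) z).
Proof.
move=> chiB.
have tB : balanced (fun b (x : H) => tgt H b * x) g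
    (fun x1 x2 => phi x1 ⊠ x2 : PH).
  by balance; rewrite phi_tgt ten_bal.
rewrite -(tsum_ten x 1 tB) -(tsum_lambda_inv _ tB).
rewrite (linear_tsum (L := fun z => tsum (kap z) chi)); last by lin.
apply: eq_tsum => y z.
have -> : tsum (comul H y) (fun y1 y2 => phi y1 ⊠ (y2 * z) : PH)
    = tsum (coact P (phi y)) (fun a0 a1 => a0 ⊠ (a1 * z)).
  rewrite (tsum_coact_colinear phi_coact) //.
  exact/testMr/ten_balanced.
by rewrite (kap_can canK) tsum_ten.
Qed.

Let F := translate kap r id.

Let idb b (u : P) : id (u * bar P b) = id u * bar P b. Proof. by []. Qed.

Let Fl : linear F.
Proof. exact: (translate_lin canK kapK r_tgt (@lin_id k P) idb). Qed.

Lemma coact_translate_id q : coact P (F q) = F q ⊠ 1.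
Proof.
have F1 u : translate kap r (fun a => 1 * a) u = F u.
  by apply: eq_tsum => a x; rewrite mul1r.
rewrite -F1.
rewrite (@coact_translate _ _ _ _ _ canK kapK _ i_coinv _ _ phi_tgt phi_src
  phi_coact r_tgt r_src phi_r r_phi P (fun m u => m * u)).
- rewrite -(rmorph1 (bar P)) coact_bar tenE tsum_ten ?(rmorph1 (bar P)).
    by rewrite (rmorph1 (tgt H)).
  rewrite /translate; balance.
  rewrite -ten_bal tsum_mull; congr (_ ⊠ _).
  by apply: eq_tsum => a x; rewrite !mulrA.
- by move=> m; lin.
- by move=> m; lin.
- by move=> b m u; rewrite mulrA.
- by move=> b m u; rewrite mulrA.
- by move=> b m u; rewrite mulrA.
move=> u; rewrite -[LHS]tsum_id tsum_coactM; last exact: ten_balanced.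
exact: tsum_exchange.
Qed.

Lemma translate_phi x : F (phi x) = i (counit H x).
Proof.
rewrite /F /translate tsum_kap_colinear ?phi_r //; balance.
by rewrite r_tgt mulrA.
Qed.

Hypothesis i_inj : injective i.
Hypothesis i_onto : forall p, coact P p = p ⊠ 1 -> exists b, i b = p.

Lemma cleft_trivialization :
  exists psi : {linear P -> H}, cancel phi psi /\ cancel psi phi.
Proof.
(* F lands in i(B); preimages are chosen pointwise, and their linearity follows from that of F
   because [i] is injective. *)
have [fF fE] := choice (fun q => i_onto (coact_translate_id q)).
have fl : linear fF by move=> c u v; apply: i_inj; rewrite fE (Fl c u v) -!fE linearP.
have fb b q : fF (bar P b * q) = fF q * b.
  apply: i_inj; rewrite iM !fE.
  exact: (translate_barl canK kapK r_tgt r_src (@lin_id k P) idb).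
have fphi x : fF (phi x) = counit H x by apply: i_inj; rewrite fE translate_phi.
have tB : balanced f g (fun a x => src H (fF a) * x).
  by balance; rewrite fb rmorphM mulrA.
have psil : linear (fun p => tsum (coact P p) (fun a x => src H (fF a) * x)).
  by lin.
have [psi psiE] := linear_pack psil.
exists psi; split=> [x|p]; rewrite psiE.
  rewrite (tsum_coact_colinear phi_coact) //.
  by under eq_tsum do rewrite fphi; rewrite tsum_counitl.
rewrite tsum_app; under eq_tsum do rewrite phi_src fE.
exact: (tsum_translate canK kapK phi_src r_tgt r_src r_phi
  (@lin_id k P) idb).
Qed.

Variable psi : {linear P -> H}.
Hypothesis phiK : cancel phi psi.
Hypothesis psiK : cancel psi phi.

Notation e := (trace psi).
Let el : linear e := trace_lin psi.
Let e_src b p : e (i b * p) = b * e p := trace_srcM phiK psiK phi_src b p.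
Let e_tgt b p : e (bar P b * p) = e p * b := trace_tgtM phiK psiK phi_tgt b p.
Let psi_tgt b p : psi (bar P b * p) = tgt H b * psi p :=
  psi_tgtM phiK psiK phi_tgt b p.
Let psi_mtgt b p : psi (p * bar P b) = psi p * tgt H b :=
  psi_mul_tgt phiK psiK phi_tgt phi_coact b p.
Let psi_src b p : psi (i b * p) = src H b * psi p :=
  psi_srcM phiK psiK phi_src b p.
Let phi_mtgt b (x : H) : phi (x * tgt H b) = phi x * bar P b :=
  colinear_mul_tgt phi_tgt phi_coact b x.
Let eB : balanced f g (fun a x => i (e a) * phi x) :=
  trace_test_balanced phiK psiK phi_tgt phi_src.

Let L (x : H) (u : P) : P := phi (x * psi u).
(* phi(x y_+) r(y_-), which is Gamma'(x_1, y) phi(x_2) *)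
Let N (x y : H) : P := translate kap r (L x) (phi y).

Let Ll x : linear (L x). Proof. by rewrite /L; lin. Qed.
Let Lr u : linear (L^~ u). Proof. by rewrite /L; lin. Qed.
Let Lb x b u : L x (u * bar P b) = L x u * bar P b.
Proof. by rewrite /L psi_mtgt mulrA phi_mtgt. Qed.
Let Lbarl b x u : L (tgt H b * x) u = bar P b * L x u.
Proof. by rewrite /L -mulrA phi_tgt. Qed.
Let Lbarr b x u : L (x * tgt H b) u = L x (bar P b * u).
Proof. by rewrite /L psi_tgt mulrA. Qed.

Let L_coact x u : coact P (L x u)
  = tsum (comul H x) (fun m y =>
      tsum (coact P u) (fun u0 u1 => L m u0 ⊠ (y * u1))).
Proof.
have tB : balanced (fun b (x : H) => tgt H b * x) g
    (fun x1 x2 => phi x1 ⊠ x2 : PH).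
  by balance; rewrite phi_tgt ten_bal.
have [Sl Sr Sb] := tsum_comulM_balanced tB x.
have SB : balanced f g (fun u0 u1 =>
    tsum (comul H x) (fun m y => L m u0 ⊠ (y * u1) : PH)).
  rewrite /L; balance; rewrite psi_tgt; exact: Sb.
rewrite tsum_exchange -[u in RHS]psiK (tsum_coact_colinear phi_coact _ SB).
rewrite /L phi_coact (tsum_comulM tB).
by apply: eq_tsum => u1 u2; apply: eq_tsum => x1 x2; rewrite phiK.
Qed.

Let N_coact x y : coact P (N x y) = tsum (comul H x) (fun x1 x2 => N x1 y ⊠ x2).
Proof.
exact: (@coact_translate _ _ _ _ _ canK kapK _ i_coinv _ _ phi_tgt phi_src
  phi_coact r_tgt r_src phi_r r_phi (regular H) L Ll Lr (fun b m => Lb m b)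
  Lbarl Lbarr x (L_coact x)).
Qed.

Let Nl y : linear (N^~ y). Proof. by rewrite /N /translate; lin. Qed.
Let Nr x : linear (N x).
Proof.
apply: (lin_comp (translate_lin canK kapK r_tgt (Ll x) (Lb x))).
by lin.
Qed.

Let N_tgtl b x y : N (tgt H b * x) y = bar P b * N x y.
Proof.
by rewrite /N /translate tsum_mull; apply: eq_tsum => a z; rewrite Lbarl mulrA.
Qed.

Let N_srcl b x y : N (src H b * x) y = i b * N x y.
Proof.
rewrite /N /translate tsum_mull; apply: eq_tsum => a z.
by rewrite /L -mulrA phi_src mulrA.
Qed.

Let N_tgtr b x y : N x (tgt H b * y) = N x y * i b.
Proof.
rewrite /N phi_tgt.
exact: (translate_barl canK kapK r_tgt r_src (Ll x) (Lb x)).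
Qed.

Let LrB x : balanced f' g' (fun a z => L x a * r z).
Proof. by balance; rewrite Lb r_tgt mulrA. Qed.

Let N_bal b x y : N (x * src H b) y = N x (src H b * y).
Proof.
rewrite /N phi_src /translate (tsum_kap_coinvMl canK kapK (LrB x)) //.
by apply: eq_tsum => a z; rewrite /L psi_src mulrA.
Qed.

Let r1 : r 1 = 1.
Proof.
have := phi_r 1; rewrite lambda_inv1 tsum_ten.
  by rewrite phi1 mul1r counit1 (rmorph1 i).
by balance; rewrite phi_mtgt r_tgt mulrA.
Qed.

Let N_one x : N x 1 = phi x.
Proof.
rewrite /N /translate (tsum_kap_colinear _ (LrB x)).
rewrite lambda_inv1 tsum_ten.
  by rewrite /L phiK r1 !mulr1.
by balance; rewrite phi_mtgt Lb r_tgt mulrA.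
Qed.

Let N_expand x y :
  N x y = tsum (comul H x) (fun x1 x2 => i (e (N x1 y)) * phi x2).
Proof.
rewrite -[LHS](tsum_trace phiK psiK phi_tgt phi_src phi_coact) N_coact.
by rewrite (tsum_tsum _ _ eB); apply: eq_tsum => x1 x2; rewrite tsum_ten.
Qed.

Let N_phi x y :
  tsum (comul H y) (fun y1 y2 => N x y1 * phi y2) = phi (x * y).
Proof.
have tl := translate_lin canK kapK r_tgt (Ll x) (Lb x).
have tB : balanced f g (fun a z => translate kap r (L x) a * phi z).
  balance; rewrite phi_src mulrA.
  by rewrite (translate_barl canK kapK r_tgt r_src (Ll x) (Lb x)).
rewrite -(tsum_coact_colinear phi_coact _ tB).
rewrite (tsum_translate canK kapK phi_src r_tgt r_src r_phi (Ll x) (Lb x)).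
by rewrite /L phiK.
Qed.

Let G (x y : H) : B := e (phi x * phi y).

Let Gl y : linear (G^~ y). Proof. by rewrite /G; lin. Qed.
Let Gr x : linear (G x). Proof. by rewrite /G; lin. Qed.
Let G_tgtl b x y : G (tgt H b * x) y = G x y * b.
Proof. by rewrite /G phi_tgt -mulrA e_tgt. Qed.
Let G_srcl b x y : G (src H b * x) y = b * G x y.
Proof. by rewrite /G phi_src -mulrA e_src. Qed.
Let G_bal b x y : G (x * tgt H b) y = G x (tgt H b * y).
Proof. by rewrite /G phi_mtgt phi_tgt mulrA. Qed.

Let S (x y1 y2 : H) : P :=
  tsum (comul H x) (fun x1 x2 => i (G x1 y1) * N x2 y2).
(* Gamma(x_1, y_1) N(x_2, y_2); multiplied by phi(y_3) it becomes
   phi x * phi y, and [tsum_kap_cleft] cancels phi(y_3). *)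
Let Q (x y : H) : P := tsum (comul H y) (S x).

Let S_test y1 y2 : balanced (fun b (x : H) => tgt H b * x) g
  (fun x1 x2 => i (G x1 y1) * N x2 y2).
Proof. by balance; rewrite G_tgtl iM N_srcl mulrA. Qed.

Let SB x : balanced (fun b (x : H) => tgt H b * x) g (S x).
Proof.
rewrite /S; balance.
under eq_tsum do rewrite -G_bal.
rewrite (tsum_comul_takeuchi (S_test _ _)).
by apply: eq_tsum => x1 x2; rewrite N_bal.
Qed.

Let S_tgtr b x y1 y2 : S x y1 (tgt H b * y2) = S x y1 y2 * i b.
Proof. by rewrite /S tsum_mulr; apply: eq_tsum => ? ?; rewrite N_tgtr mulrA. Qed.

Let Q_lin x : linear (Q x).
Proof. by have := SB x; rewrite /Q => hB; lin. Qed.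

Let Q_tgt b x y : Q x (tgt H b * y) = Q x y * i b.
Proof.
rewrite /Q (tsum_comul_tgtl (SB x)) tsum_mulr.
by apply: eq_tsum => y1 y2; rewrite S_tgtr.
Qed.

Let Q_phi x y : tsum (comul H y) (fun y1 y2 => Q x y1 * phi y2) = phi x * phi y.
Proof.
rewrite (tsum_trace_mul phiK psiK phi_tgt phi_src phi_coact).
under eq_tsum do rewrite /Q tsum_mulr.
have [Sl Sr Sb] := SB x.
rewrite (@coassocH _ _ _ _ (fun y1 y2 y3 => S x y1 y2 * phi y3)).
- apply: eq_tsum => y1 y2; rewrite /S.
  under eq_tsum do rewrite tsum_mulr.
  rewrite tsum_exchange; apply: eq_tsum => x1 x2; rewrite -N_phi tsum_mull.
  by apply: eq_tsum => y3 y4; rewrite mulrA.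
- by move=> ? ?; lin.
- by move=> ? ?; lin.
- by move=> ? ?; lin.
- by move=> b y1 y2 y3; rewrite Sb.
- by move=> b y1 y2 y3; rewrite S_tgtr phi_src mulrA.
Qed.

(** Inserting q (x) 1 = q_+(0) (x) phi(q_+(1)) r(q_-) at q = phi(y), [Q_phi] leaves phi(x) q_+
    r(q_-) = phi(x) F(phi(y)), and F(phi(y)) = i(eps(y)). *)
Let Q_val x y : Q x y = phi x * i (counit H y).
Proof.
have -> : Q x y = Q x (psi (phi y)) * 1 by rewrite phiK mulr1.
rewrite -(@tsum_kap_cleft _ _ _ _ _ kapK _ _ _ phi_tgt phi_src phi_coact r_tgt
  phi_r _ (fun u p => Q x (psi u) * p)).
- rewrite -translate_phi /F /translate tsum_mull.
  apply: eq_tsum => a z; rewrite /= mulrA -[a in RHS]psiK -Q_phi.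
  rewrite -[a in LHS]psiK (tsum_coact_colinear phi_coact).
    rewrite tsum_mulr; apply: eq_tsum => a1 a2.
    by rewrite phiK !mulrA.
  by balance; rewrite psi_tgt Q_tgt phi_src !mulrA.
- by move=> p; lin.
- by move=> p; lin.
- by move=> b u p; rewrite psi_tgt Q_tgt mulrA.
Qed.

Lemma cleft_cocycle :
  exists G : {linear HtH H -> B}, invertible_cocycle G /\ iso_twist P G.
Proof.
have GB : balanced (fun b (x : H) => x * tgt H b)
    (fun b (x : H) => tgt H b * x) G by balance; exact: G_bal.
have eNB : balanced (fun b (x : H) => x * src H b) g (fun x y => e (N x y)).
  by balance; rewrite N_bal.
have [G0 G0E] : exists G0 : {linear HtH H -> B}, forall z, G0 z = tsum z G.
  by apply: linear_pack; lin.
have [G1 G1E] : exists G1 : {linear HsH H -> B},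
    forall z, G1 z = tsum z (fun x y => e (N x y)).
  by apply: linear_pack; lin.
have G0t (x y : H) : G0 (x ⊗ y) = G x y by rewrite tenE G0E tsum_ten.
have G1t (x y : H) : G1 (x ⊗ y) = e (N x y) by rewrite tenE G1E tsum_ten.
(* Hence the cocycle identity below is associativity of P. *)
have tm (x y : H) : twist_mul G0 x y = psi (phi x * phi y).
  rewrite /twist_mul sweedler2E (tsum_trace_mul phiK psiK phi_tgt phi_src phi_coact).
  rewrite tsum_app; apply: eq_tsum => y1 y2; rewrite tsum_app.
  by apply: eq_tsum => x1 x2; rewrite G0t psi_src phiK mulrA.
exists G0; split; last first.
  exists phi; split=> //.
  - by exists psi.
  - by move=> x y; rewrite tm psiK.
  - by move=> b; exact: (phi_tgtE phi1 phi_tgt).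
  - by move=> x; rewrite phi_coact tsumE; apply: eq_tsum => ? ?; rewrite tenE.
split.
  split=> [b c x y|x y z|x|x]; rewrite ?G0t ?tm.
  - by rewrite -mulrA G_srcl G_tgtl mulrA.
  - by rewrite /G !psiK mulrA.
  - by rewrite /G phi1 mul1r trace_phi.
  - by rewrite /G phi1 mulr1 trace_phi.
exists G1; split=> [b c x y|b x y|x y|x y]; rewrite ?sweedler2E ?G0t ?G1t.
- by rewrite -mulrA N_srcl N_tgtl e_src e_tgt mulrA.
(* Here N(x, \bar b y) = N(x, y) i(b); after expanding N(x, y), the last factor is phi(x_2) i(b) =
   N(x_2, \bar b). *)
- rewrite N_tgtr N_expand tsum_mulr (linear_tsum (L := e)) // tsumE.
  apply: eq_tsum => x1 x2; rewrite !G1t -mulrA e_src -[tgt H b]mulr1 N_tgtr.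
  by rewrite N_one.
(* The two inverse laws are the traces of [Q_val] and of [N_phi]. *)
- rewrite /G (phi_srcE phi1 phi_src) -Q_val (linear_tsum (L := e)) //.
  apply: eq_tsum => y1 y2; rewrite (linear_tsum (L := e)) //.
  by apply: eq_tsum => x1 x2; rewrite !G0t !G1t e_src.
- rewrite -(trace_phi phiK) -N_phi (linear_tsum (L := e)) //.
  apply: eq_tsum => y1 y2; rewrite N_expand tsum_mulr (linear_tsum (L := e)) //.
  by apply: eq_tsum => x1 x2; rewrite G0t G1t -mulrA e_src.
Qed.

End CleftCocycle.

(** * Normalisation of a cleaving *)

Lemma coact_one (k : fieldType) (B : algType k) (H : left_bialgebroid B)
    (P : comodule_algebra H) : coact P 1 = 1 ⊠ 1.
Proof. by rewrite -(rmorph1 (bar P)) coact_bar tenE (rmorph1 (tgt H)) (rmorph1 (bar P)). Qed.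

(** Multiply the coaction of c d = 1 by d on the left of the first factor. This is well defined on P
    <> H because d, like c, commutes with every \bar b. *)
Lemma coinvariant_inverse (k : fieldType) (B : algType k)
    (H : left_bialgebroid B) (P : comodule_algebra H) (c d : P) :
  c * d = 1 -> d * c = 1 -> coact P c = c ⊠ 1 -> coact P d = d ⊠ 1.
Proof.
move=> cd dc cc; have cbar b := coinvariant_barC b cc.
have dbar b : d * bar P b = bar P b * d.
  by rewrite -[LHS]mulr1 -cd mulrA -[d * _ * c]mulrA -cbar mulrA dc mul1r.
have dB : balanced (fun (b : B) (p : P) => bar P b * p)
    (fun (b : B) (x : H) => src H b * x)
    (fun a x => (d * a) ⊠ x : diamond (src H) (bar P)).
  by balance; rewrite mulrA dbar -mulrA ten_bal.
have := tsum_coinvMl d dB cc; rewrite cd coact_one tsum_ten // mulr1 => ->.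
rewrite -[LHS]tsum_id; apply: eq_tsum => a x.
by rewrite mulrA dc mul1r.
Qed.

Lemma anti_cleft_extension_cocycle (k : fieldType) (B : algType k)
    (H : hopf_algebroid B) (P : comodule_algebra H) :
  anti_cleft_extension P ->
  exists G : {linear HtH H -> B}, invertible_cocycle G /\ iso_twist P G.
Proof.
case=> i [[[kap canK kapK] i_inj ic [rt [[rt_tgt rt_coact] rt_src
  [r [r_tgt r_src rtr rrt]]]]] i_onto].
have i_coinv b : coact P (i b) = i b ⊠ 1 by rewrite -tenE; exact: ic.
have rt_coact' (x : H) :
    coact P (rt x) = tsum (comul H x) (fun x1 x2 => rt x1 ⊠ x2).
  by rewrite rt_coact tsumE; apply: eq_tsum => ? ?; rewrite tenE.
have rtr' (x : H) :
    tsum (lambda_inv (x ⊠ 1)) (fun y z : H => rt y * r z) = i (counit H x).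
  by rewrite -rtr /translp tenE tsumE.
have rrt' (x : H) :
    tsum (mu_inv (1 ⊠ x)) (fun y z : H => r y * rt z) = bar P (counit H x).
  by rewrite -rrt /transrp tenE tsumE.
have rt_balanced : balanced (fun b (x : H) => x * tgt H b)
    (fun b (x : H) => tgt H b * x) (fun y z : H => rt y * r z).
  by balance; rewrite (colinear_mul_tgt rt_tgt rt_coact') r_tgt mulrA.
have r_balanced : balanced (fun b (x : H) => x * src H b)
    (fun b (x : H) => src H b * x) (fun y z : H => r y * rt z).
  by balance; rewrite r_src rt_src mulrA.
(* The cleaving conditions at x = 1 make rt(1) and r(1) mutually inverse. *)
have cd : rt 1 * r 1 = 1.
  by have := rtr' 1; rewrite lambda_inv1 tsum_ten // counit1 (rmorph1 i).
have dc : r 1 * rt 1 = 1.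
  by have := rrt' 1; rewrite mu_inv1 tsum_ten // counit1 (rmorph1 (bar P)).
have cc : coact P (rt 1) = rt 1 ⊠ 1.
  rewrite rt_coact' comul1 tenE tsum_ten //; balance.
  by rewrite rt_tgt ten_bal.
have dd := coinvariant_inverse cd dc cc.
have cbar b := coinvariant_barC b cc.
have dbar b := coinvariant_barC b dd.
(* Multiplying by the coinvariant r(1) keeps [rt] colinear. The factor rt(1) in [r'] cancels against
   it in the first condition; in the second it conjugates \bar{eps(x)}, with which it commutes. *)
have [phi phiE] : exists phi : {linear H -> P}, forall x, phi x = rt x * r 1.
  by apply: linear_pack; lin.
have [r' r'E] : exists r' : {linear H -> P}, forall x, r' x = rt 1 * r x.
  by apply: linear_pack; lin.
have phi1 : phi 1 = 1 by rewrite phiE.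
have phi_tgt b (x : H) : phi (tgt H b * x) = bar P b * phi x.
  by rewrite !phiE rt_tgt mulrA.
have phi_src b (x : H) : phi (src H b * x) = i b * phi x.
  by rewrite !phiE rt_src mulrA.
have phi_coact (x : H) :
    coact P (phi x) = tsum (comul H x) (fun x1 x2 => phi x1 ⊠ x2).
  rewrite phiE -[LHS]tsum_id (tsum_coinvMr _ (ten_balanced _ _) dd).
  rewrite (tsum_coact_colinear rt_coact').
    by apply: eq_tsum => x1 x2; rewrite phiE.
  by balance; rewrite -mulrA ten_bal.
have r'_tgt b (x : H) : r' (tgt H b * x) = bar P b * r' x.
  by rewrite !r'E r_tgt !mulrA cbar.
have r'_src b (x : H) : r' (x * src H b) = r' x * i b.
  by rewrite !r'E r_src mulrA.
have phi_r (x : H) :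
    tsum (lambda_inv (x ⊠ 1)) (fun y z : H => phi y * r' z) = i (counit H x).
  rewrite -rtr'; apply: eq_tsum => y z.
  by rewrite phiE r'E mulrA -[rt y * _ * _]mulrA dc mulr1.
have r_phi (x : H) :
    tsum (mu_inv (1 ⊠ x)) (fun y z : H => r' y * phi z) = bar P (counit H x).
  transitivity (rt 1 * bar P (counit H x) * r 1).
    rewrite -rrt' tsum_mull tsum_mulr; apply: eq_tsum => y z.
    by rewrite phiE r'E !mulrA.
  by rewrite cbar -mulrA cd mulr1.
have i_onto' p : coact P p = p ⊠ 1 -> exists b, i b = p.
  by rewrite -tenE; exact: i_onto.
have [psi [phiK psiK]] := cleft_trivialization canK kapK i_coinv phi_tgt
  phi_src phi_coact r'_tgt r'_src phi_r r_phi i_inj i_onto'.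
exact: (cleft_cocycle canK kapK i_coinv phi1 phi_tgt phi_src phi_coact r'_tgt
  r'_src phi_r r_phi phiK psiK).
Qed.

(** * The cleaving of a cocycle *)

Section CocycleCleft.
Variables (k : fieldType) (B : algType k) (H : hopf_algebroid B).
Variable P : comodule_algebra H.
Implicit Types (V : lmodType k) (b : B).

Notation f := (fun (b : B) (p : P) => bar P b * p).
Notation g := (fun (b : B) (x : H) => src H b * x).
Notation ft := (fun (b : B) (x : H) => tgt H b * x).

Variable i : {lrmorphism B -> P}.
Hypothesis i_coinv : forall b, coact P (i b) = i b ⊠ 1.

Variables (phi : {linear H -> P}) (psi : {linear P -> H}).
Hypothesis phiK : cancel phi psi.
Hypothesis psiK : cancel psi phi.
Hypothesis phi1 : phi 1 = 1.
Hypothesis phi_tgt : forall b (x : H), phi (tgt H b * x) = bar P b * phi x.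
Hypothesis phi_src : forall b (x : H), phi (src H b * x) = i b * phi x.
Hypothesis phi_coact : forall x : H,
  coact P (phi x) = tsum (comul H x) (fun x1 x2 => phi x1 ⊠ x2).

Notation e := (trace psi).
Notation G x y := (e (phi x * phi y)).

Variable G' : H -> H -> B.
Hypothesis G'l : forall y, linear (G'^~ y).
Hypothesis G'r : forall x, linear (G' x).
Hypothesis G'_bal : forall b x y, G' (x * src H b) y = G' x (src H b * y).
Hypothesis G'_srcl : forall b x y, G' (src H b * x) y = b * G' x y.
Hypothesis G'_tgtl : forall b x y, G' (tgt H b * x) y = G' x y * b.
Hypothesis G'_tgtr : forall b x y, G' x (tgt H b * y)
  = tsum (comul H x) (fun x1 x2 => (G' x1 y * G' x2 (tgt H b) : B)).
Hypothesis GG' : forall x y : H,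
  tsum (comul H y) (fun y1 y2 => tsum (comul H x) (fun x1 x2 =>
    (G x1 y1 * G' x2 y2 : B))) = G x (src H (counit H y)).
Hypothesis G'G : forall x y : H,
  tsum (comul H y) (fun y1 y2 => tsum (comul H x) (fun x1 x2 =>
    (G' x1 y1 * G x2 y2 : B))) = counit H (x * y).

Let el : linear e := trace_lin psi.
Let e_src b p : e (i b * p) = b * e p := trace_srcM phiK psiK phi_src b p.
Let e_tgt b p : e (bar P b * p) = e p * b := trace_tgtM phiK psiK phi_tgt b p.
Let psi_tgt b p : psi (bar P b * p) = tgt H b * psi p :=
  psi_tgtM phiK psiK phi_tgt b p.
Let psi_src b p : psi (i b * p) = src H b * psi p :=
  psi_srcM phiK psiK phi_src b p.
Let phi_mtgt b (x : H) : phi (x * tgt H b) = phi x * bar P b :=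
  colinear_mul_tgt phi_tgt phi_coact b x.
Let eB : balanced f g (fun a x => i (e a) * phi x) :=
  trace_test_balanced phiK psiK phi_tgt phi_src.
Let iC (b c : B) : i b * bar P c = bar P c * i b :=
  coinvariant_barC c (i_coinv b).
Let iM (b c : B) : i (b * c) = i b * i c := rmorphM i b c.
Let phi_srcE b : phi (src H b) = i b := phi_srcE phi1 phi_src b.

Let G_tgtl b x y : G (tgt H b * x) y = G x y * b.
Proof. by rewrite phi_tgt -mulrA e_tgt. Qed.
Let G_bal b x y : G (x * tgt H b) y = G x (tgt H b * y).
Proof. by rewrite phi_mtgt phi_tgt mulrA. Qed.

(** Take x = 1 in [GG']: Gamma(1, x_1) = eps(x_1) is absorbed by Gamma'(1, x_2) as a source factor
    of x_2. *)
Let G'_one x : G' 1 x = counit H x.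
Proof.
have := GG' 1 x; rewrite phi1 mul1r trace_phi // counit_srcE => <-.
rewrite -[in LHS](tsum_counitl x) (linear_tsum (L := G' 1)) //.
apply: eq_tsum => x1 x2; rewrite -G'_bal mul1r -[src H _]mulr1 G'_srcl.
rewrite comul1 tenE tsum_ten ?phi1 ?mul1r ?trace_phi //.
by balance; rewrite G_tgtl G'_srcl mulrA.
Qed.

(** Take y = \bar b in [GG']: its coproduct is 1 (x) \bar b, and Gamma(x_1, 1) = eps(x_1). *)
Let G'_tgt b x : G' x (tgt H b) = G x (src H b).
Proof.
have := GG' x (tgt H b); rewrite counit_tgtE => <-.
have tB y1 y2 : balanced ft g (fun x1 x2 => (G x1 y1 * G' x2 y2 : B)).
  by balance; rewrite G_tgtl G'_srcl mulrA.
rewrite comul_tgt tenE tsum_ten.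
  rewrite -[in LHS](tsum_counitl x) (linear_tsum (L := G'^~ _)) //.
  by apply: eq_tsum => x1 x2; rewrite phi1 mulr1 trace_phi // G'_srcl.
balance; under eq_tsum do rewrite -G_bal.
rewrite (tsum_comul_takeuchi (tB _ _)).
by apply: eq_tsum => x1 x2; rewrite G'_bal.
Qed.

(** The counterpart of [N], now built from Gamma' instead of from a cleaving. *)
Let n (x y : H) : P := tsum (comul H x) (fun x1 x2 => i (G' x1 y) * phi x2).

Let n_test y : balanced ft g (fun x1 x2 => i (G' x1 y) * phi x2).
Proof. by balance; rewrite G'_tgtl iM phi_src mulrA. Qed.

Let nl y : linear (n^~ y).
Proof. by have := n_test y; rewrite /n => hB; lin. Qed.
Let nr x : linear (n x). Proof. by rewrite /n; lin. Qed.

Let n_bal b x y : n (x * src H b) y = n x (src H b * y).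
Proof.
rewrite /n (tsum_comul_srcr (n_test _)).
by apply: eq_tsum => ? ?; rewrite G'_bal.
Qed.

Let n_srcl b x y : n (src H b * x) y = i b * n x y.
Proof.
rewrite /n (tsum_comul_srcl (n_test _)) tsum_mull.
by apply: eq_tsum => ? ?; rewrite G'_srcl iM mulrA.
Qed.

Let n_tgtl b x y : n (tgt H b * x) y = bar P b * n x y.
Proof.
rewrite /n (tsum_comul_tgtl (n_test _)) tsum_mull.
by apply: eq_tsum => ? ?; rewrite phi_tgt mulrA iC mulrA.
Qed.

Let n_mtgt b x y : n (x * tgt H b) y = n x y * bar P b.
Proof.
rewrite /n (tsum_comul_tgtr (n_test _)) tsum_mulr.
by apply: eq_tsum => ? ?; rewrite phi_mtgt mulrA.
Qed.

Let G_src b (x : H) :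
  tsum (comul H x) (fun x1 x2 => i (G x1 (src H b)) * phi x2) = phi x * i b.
Proof.
rewrite -[RHS](tsum_trace phiK psiK phi_tgt phi_src phi_coact).
rewrite (tsum_coinvMr _ eB (i_coinv b)) (tsum_coact_colinear phi_coact).
  by rewrite phi_srcE.
have [t1 t2 t3] := eB; balance.
by rewrite -mulrA t3.
Qed.

(** The axiom for Gamma'(x, \bar b y) splits off Gamma'(x_2, \bar b) = Gamma(x_2, b), which by
    [G_src] is right multiplication by i(b). *)
Let n_tgtr b x y : n x (tgt H b * y) = n x y * i b.
Proof.
rewrite /n; under eq_tsum do rewrite G'_tgtr tsum_app tsum_mulr.
rewrite (@coassocH _ _ _ _
  (fun x1 x2 x3 => i (G' x1 y * G' x2 (tgt H b)) * phi x3)).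
- rewrite tsum_mulr; apply: eq_tsum => x1 x2; rewrite -mulrA -G_src tsum_mull.
  by apply: eq_tsum => x3 x4; rewrite G'_tgt iM mulrA.
- by move=> ? ?; lin.
- by move=> ? ?; lin.
- by move=> ? ?; lin.
- by move=> c x1 x2 x3; rewrite G'_tgtl G'_srcl mulrA.
- by move=> c x1 x2 x3; rewrite G'_tgtl phi_src !iM !mulrA.
Qed.

Let n_coact V (tst : P -> H -> V) x y : balanced f g tst ->
  tsum (coact P (n x y)) tst = tsum (comul H x) (fun x1 x2 => tst (n x1 y) x2).
Proof.
move=> tB; have [t1 t2 t3] := tB.
rewrite (linear_tsum (L := fun z => tsum (coact P z) tst)); last by lin.
transitivity (tsum (comul H x) (fun x1 x2 => tsum (comul H x2)
    (fun x3 x4 => tst (i (G' x1 y) * phi x3) x4))).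
  apply: eq_tsum => x1 x2; rewrite tsum_coinvMl //.
  rewrite (tsum_coact_colinear phi_coact) //; balance.
  by rewrite mulrA iC -mulrA t3.
rewrite -(@coassocH _ _ _ _ (fun x1 x2 x3 => tst (i (G' x1 y) * phi x2) x3)).
- apply: eq_tsum => x1 x2.
  by rewrite -(linear_tsum (L := tst^~ x2)).
- by move=> ? ?; lin.
- by move=> ? ?; lin.
- by move=> ? ?; lin.
- by move=> c x1 x2 x3; rewrite G'_tgtl iM phi_src mulrA.
- by move=> c x1 x2 x3; rewrite phi_tgt mulrA iC -mulrA t3.
Qed.

(** The two sides have the same trace, by [G'G]. Both coactions are obtained by applying the same
    expression to x_1, y_1 and putting x_2 y_2 on the right, so [tsum_trace] upgrades equal traces
    to equality. *)
Let n_phi (x y : H) :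
  tsum (comul H y) (fun y1 y2 => n x y1 * phi y2) = phi (x * y).
Proof.
pose h u v := tsum (comul H v) (fun y1 y2 => n u y1 * phi y2).
have hE u v : e (h u v) = counit H (u * v).
  rewrite -G'G /h (linear_tsum (L := e)) //; apply: eq_tsum => y1 y2.
  rewrite /n tsum_mulr (linear_tsum (L := e)) //; apply: eq_tsum => x1 x2.
  by rewrite -mulrA e_src.
have cB : balanced ft g (fun u v => src H (counit H u) * v).
  by balance; rewrite counit_tgtM rmorphM mulrA.
rewrite -/(h x y) -[in RHS](tsum_counitl (x * y)) (tsum_comulM cB).
rewrite -[LHS](tsum_trace phiK psiK phi_tgt phi_src phi_coact).
rewrite {1}/h (linear_tsum (L := fun z => tsum (coact P z) _)); last by lin.
under eq_tsum do rewrite (tsum_coactM _ _ eB).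
have mB p : balanced f g (fun a z => tsum (coact P p) (fun a' z' =>
    i (e (a' * a)) * phi (z' * z))) := tsum_coactM_balanced p eB.
have rB a z : balanced f g (fun a' z' => i (e (a' * a)) * phi (z' * z)) :=
  mul_test_balanced eB a z.
under eq_tsum do rewrite (tsum_coact_colinear phi_coact _ (mB _)).
under eq_tsum do under eq_tsum do rewrite (n_coact _ _ (rB _ _)).
have tB y1 y2 y3 : balanced ft g
    (fun x1 x2 => i (e (n x1 y1 * phi y2)) * phi (x2 * y3)).
  by balance; rewrite n_tgtl -mulrA e_tgt iM -[src H _ * _ * _]mulrA phi_src mulrA.
rewrite -(@coassocH _ _ _ _ (fun y1 y2 y3 => tsum (comul H x)
  (fun x1 x2 => i (e (n x1 y1 * phi y2)) * phi (x2 * y3)))).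
- rewrite tsum_app; apply: eq_tsum => y1 y2; rewrite tsum_exchange tsum_app.
  apply: eq_tsum => x1 x2; rewrite phi_src -hE /h.
  rewrite (linear_tsum (L := fun z => i (e z) * _)) //; lin.
- by move=> ? ?; lin.
- by move=> ? ?; lin.
- by move=> ? ?; lin.
- move=> b y1 y2 y3; apply: eq_tsum => x1 x2.
  by rewrite n_tgtr phi_src !mulrA.
- move=> b y1 y2 y3; under eq_tsum do rewrite phi_tgt mulrA -n_mtgt.
  rewrite (tsum_comul_takeuchi (tB y1 y2 y3)).
  by apply: eq_tsum => x1 x2; rewrite mulrA.
Qed.

Let nB : balanced (fun b (x : H) => x * src H b) g n.
Proof. by balance; exact: n_bal. Qed.

Let mui := @mu_inv_lin k B H.

(* The map x_1 y (x) x_2 |-> n x y on H <> H; the cleaving is r = nu 1. *)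
Let nu (x y : H) : P := tsum (mu_inv (x ⊠ y)) n.

Let nul y : linear (nu^~ y). Proof. by rewrite /nu; lin. Qed.
Let nur x : linear (nu x). Proof. by rewrite /nu; lin. Qed.

Let nu_mu x y : tsum (comul H x) (fun x1 x2 => nu (x1 * y) x2) = n x y.
Proof.
rewrite -(linear_tsum (L := fun z => tsum (mu_inv z) n)); last by lin.
by rewrite mu_invE tsum_ten.
Qed.

Let nu_bal b x y : nu (tgt H b * x) y = nu x (src H b * y).
Proof. by rewrite /nu ten_bal. Qed.

Let nu_src b x y : nu (src H b * x) y = i b * nu x y.
Proof.
rewrite /nu (tsum_mu_inv_srcl nB) tsum_mull.
by apply: eq_tsum => ? ?; rewrite n_srcl.
Qed.

Let nu_srcr b x y : nu x (y * src H b) = nu x y * i b.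
Proof.
rewrite /nu (tsum_mu_inv_srcr nB) tsum_mulr.
by apply: eq_tsum => ? ?; rewrite n_tgtr.
Qed.

Let nu_tgt b x y : nu x (tgt H b * y) = bar P b * nu x y.
Proof.
rewrite /nu (tsum_mu_inv_tgt nB) tsum_mull.
by apply: eq_tsum => ? ?; rewrite n_tgtl.
Qed.

Let nuB : balanced ft g nu.
Proof. by balance; exact: nu_bal. Qed.

Let nu_test p : balanced f g (fun a x => nu (psi (a * p)) x).
Proof. by balance; rewrite -mulrA psi_tgt nu_bal. Qed.

(** For p = phi(w), expanding the twisted product gives Gamma(w_1, z_1) nu(w_2 z_2, w_3), that is
    Gamma(w_1, z_1) n(w_2, z_2). Here [GG'] enters: the sum becomes Gamma(w_1, eps(z)) phi(w_2) =
    phi(w) i(eps(z)). *)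
Let nu_coact p z :
  tsum (coact P p) (fun a x => nu (psi (a * phi z)) x) = p * i (counit H z).
Proof.
rewrite -[p]psiK; move: (psi p) => w {p}.
rewrite (tsum_coact_colinear phi_coact _ (nu_test _)).
transitivity (tsum (comul H z) (fun z1 z2 => tsum (comul H w) (fun w1 w2 =>
    i (G w1 z1) * n w2 z2))).
  transitivity (tsum (comul H z) (fun z1 z2 => tsum (comul H w) (fun w1 w2 =>
      tsum (comul H w1) (fun w3 w4 => i (G w3 z1) * nu (w4 * z2) w2)))).
    rewrite -tsum_exchange; apply: eq_tsum => w1 w2.
    rewrite (tsum_trace_mul phiK psiK phi_tgt phi_src phi_coact).
    rewrite (linear_tsum (L := fun p => nu (psi p) w2)); last by lin.
    apply: eq_tsum => z1 z2.
    rewrite (linear_tsum (L := fun p => nu (psi p) w2)); last by lin.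
    by apply: eq_tsum => w3 w4; rewrite psi_src phiK nu_src.
  apply: eq_tsum => z1 z2.
  rewrite (@coassocH _ _ _ _ (fun w1 w2 w3 => i (G w1 z1) * nu (w2 * z2) w3)).
  - by apply: eq_tsum => w1 w2; rewrite -nu_mu tsum_mull.
  - by move=> ? ?; lin.
  - by move=> ? ?; lin.
  - by move=> ? ?; lin.
  - by move=> b w1 w2 w3; rewrite G_tgtl iM -[src H b * _ * _]mulrA nu_src mulrA.
  - by move=> b w1 w2 w3; rewrite -mulrA nu_bal.
rewrite -G_src tsum_exchange.
under [RHS]eq_tsum do rewrite -GG' tsum_app tsum_mulr.
rewrite [RHS]tsum_exchange tsum_exchange; apply: eq_tsum => z1 z2.
under [RHS]eq_tsum do rewrite tsum_app tsum_mulr.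
rewrite (@coassocH _ _ _ _ (fun w1 w2 w3 => i (G w1 z1 * G' w2 z2) * phi w3)).
- apply: eq_tsum => w1 w2; rewrite /n tsum_mull.
  by apply: eq_tsum => w3 w4; rewrite iM mulrA.
- by move=> ? ?; lin.
- by move=> ? ?; lin.
- by move=> ? ?; lin.
- by move=> b w1 w2 w3; rewrite G_tgtl G'_srcl mulrA.
- by move=> b w1 w2 w3; rewrite G'_tgtl phi_src !iM !mulrA.
Qed.

(** Linearity of [nu] for left multiplication by phi(q), needed to evaluate phi(x_+) r(x_-). It is
    checked on the elements Y_1 Z (x) Y_2, which suffices as [mu] is onto. *)
Let nu_mul q z :
  phi q * nu 1 z = tsum (comul H q) (fun q1 q2 => nu q1 (q2 * z)).
Proof.
pose tst u v := tsum (comul H q)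
  (fun q1 q2 => nu (psi (phi q1 * phi u)) (q2 * v)).
have tB0 u v : balanced ft g
    (fun q1 q2 => nu (psi (phi q1 * phi u)) (q2 * v)).
  by balance; rewrite phi_tgt -mulrA psi_tgt nu_bal mulrA.
have tB : balanced ft g tst.
  rewrite /tst; balance.
  under eq_tsum do rewrite phi_tgt mulrA -phi_mtgt.
  rewrite (tsum_comul_takeuchi (tB0 _ _)).
  by apply: eq_tsum => ? ?; rewrite mulrA.
(* Writing n(Y, Z) = n(Y, Z_1) i(eps(Z_2)) prepares [nu_coact] with p = phi(q) n(Y, Z_1); then
   [n_phi] recombines Z. *)
have n_val Y Z : phi q * n Y Z = tsum (comul H Y) (fun Y1 Y2 => tst (Y1 * Z) Y2).
  rewrite -{1}(tsum_counitr Z) (linear_tsum (L := n Y)) // tsum_mull.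
  transitivity (tsum (comul H Z) (fun Z1 Z2 => tsum (comul H Y) (fun Y1 Y2 =>
      tsum (comul H q) (fun q1 q2 =>
        nu (psi (phi q1 * n Y1 Z1 * phi Z2)) (q2 * Y2))))).
    apply: eq_tsum => Z1 Z2; rewrite n_tgtr mulrA -nu_coact.
    rewrite (tsum_coactM _ _ (nu_test _)).
    rewrite (n_coact _ _ (tsum_coactM_balanced (phi q) (nu_test _))).
    apply: eq_tsum => Y1 Y2; rewrite (tsum_coact_colinear phi_coact) //.
    exact: (mul_test_balanced (nu_test _)).
  rewrite tsum_exchange; apply: eq_tsum => Y1 Y2; rewrite tsum_exchange.
  apply: eq_tsum => q1 q2; rewrite -n_phi tsum_mull.
  rewrite (linear_tsum (L := fun p => nu (psi p) _)); last by lin.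
  by apply: eq_tsum => Z1 Z2; rewrite mulrA.
rewrite {1}/nu tsum_mull; under eq_tsum do rewrite n_val.
rewrite (tsum_mu_inv _ tB) tsum_ten // /tst.
by apply: eq_tsum => q1 q2; rewrite phi1 mulr1 phiK.
Qed.

Lemma cocycle_cleaving : exists r : {linear H -> P},
  [/\ forall b (x : H), r (tgt H b * x) = bar P b * r x,
      forall b (x : H), r (x * src H b) = r x * i b,
      forall x : H, tsum (lambda_inv (x ⊠ 1)) (fun y z : H => phi y * r z)
                = i (counit H x)
    & forall x : H, tsum (mu_inv (1 ⊠ x)) (fun y z : H => r y * phi z)
                = bar P (counit H x)].
Proof.
have [r rE] : exists r : {linear H -> P}, forall x, r x = nu 1 x.
  exact: linear_pack.
exists r; split=> [b x|b x|x|x]; rewrite ?rE.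
- exact: nu_tgt.
- exact: nu_srcr.
(* By [nu_mul] the sum over x_+ (x) x_- collapses to nu(x, 1) = n(1, x) = i(Gamma'(1, x)). *)
- under eq_tsum do rewrite rE nu_mul.
  rewrite (tsum_lambda_inv _ nuB) tsum_ten //.
  have tB : balanced ft g (fun a c => nu (a * x) c).
    by balance; rewrite -mulrA nu_bal.
  have := nu_mu 1 x; rewrite comul1 tenE tsum_ten // mul1r => ->.
  rewrite /n comul1 tenE tsum_ten //.
  by rewrite phi1 mulr1 G'_one.
(* For the second condition, [om] is determined by om(u, v_1 w, v_2) = nu(u, v) phi(w), and the
   wanted sum is om(1, 1, x). With 1 (x) x = Y_1 Z (x) Y_2 it becomes the sum of nu(Y_1 Z_1, Y_2)
   phi(Z_2) = n(Y, Z_1) phi(Z_2) = phi(Y Z). *)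
pose om (u v w : H) : P := tsum (mu_inv (v ⊠ w)) (fun v w : H => nu u v * phi w).
have chiB u : balanced (fun b (x : H) => x * src H b) g
    (fun v w => nu u v * phi w).
  by balance; rewrite nu_srcr phi_src mulrA.
have oml v w : linear (fun u => om u v w) by rewrite /om; lin.
have omm u w : linear (fun v => om u v w).
  by have := chiB u; rewrite /om => hB; lin.
have omr u v : linear (fun w => om u v w).
  by have := chiB u; rewrite /om => hB; lin.
have omb1 b u v w : om (tgt H b * u) v w = om u (src H b * v) w.
  rewrite /om (tsum_mu_inv_srcl (chiB u)).
  by apply: eq_tsum => ? ?; rewrite nu_bal.
have omb2 b u v w : om u (tgt H b * v) w = om u v (src H b * w).
  by rewrite /om ten_bal.
have om_mu u v w :
    tsum (comul H v) (fun v1 v2 => om u (v1 * w) v2) = nu u v * phi w.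
  rewrite -(linear_tsum (L := fun z => tsum (mu_inv z) _)); last first.
    by have := chiB u => hB; lin.
  by rewrite mu_invE tsum_ten //; exact: chiB.
pose tst (u w : H) : P := tsum (comul H u) (fun u1 u2 => om u1 u2 w).
have omB w : balanced ft g (fun u1 u2 => om u1 u2 w).
  by balance; exact: omb1.
have tB : balanced ft g tst.
  rewrite /tst; balance; first exact: omB.
  rewrite (tsum_comul_tgtl (omB _)).
  by apply: eq_tsum => ? ?; rewrite omb2.
have -> : tsum (mu_inv (1 ⊠ x)) (fun y z : H => r y * phi z) = tst 1 x.
  rewrite /tst comul1 tenE (tsum_ten _ _ (omB x)).
  by apply: eq_tsum => y z; rewrite rE.
rewrite -(tsum_ten 1 x tB) -(tsum_mu_inv _ tB).
(* What remains is x_[+] x_[-] = \bar{eps(x)}, obtained by testing 1 (x) x with a (x) c |->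
   \bar{eps(c)} a. *)
have cB : balanced ft g (fun a c => tgt H (counit H c) * a).
  by balance; rewrite counit_srcM mulrA -(rmorphM (tgt H)).
have <- : phi (tgt H (counit H x)) = bar P (counit H x) := phi_tgtE phi1 phi_tgt _.
rewrite -[tgt H _]mulr1 -(tsum_ten 1 x cB) -(tsum_mu_inv _ cB) tsum_app.
apply: eq_tsum => Y Z.
have -> : tsum (comul H Y) (fun Y1 Y2 => tgt H (counit H Y2) * (Y1 * Z)) = Y * Z.
  rewrite -[in RHS](tsum_counitr Y) tsum_mulr.
  by apply: eq_tsum => ? ?; rewrite mulrA.
under eq_tsum do rewrite /tst (tsum_comulM (omB _)).
rewrite tsum_exchange -n_phi; apply: eq_tsum => Z1 Z2.
rewrite (@coassocH _ _ _ _ (fun y1 y2 y3 => om (y1 * Z1) (y2 * Z2) y3)).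
- rewrite -nu_mu tsum_mulr; apply: eq_tsum => Y1 Y2.
  by rewrite om_mu.
- by move=> ? ?; lin.
- by move=> ? ?; lin.
- by move=> ? ?; lin.
- by move=> b y1 y2 y3; rewrite -!mulrA omb1.
- by move=> b y1 y2 y3; rewrite -!mulrA omb2.
Qed.

End CocycleCleft.

Lemma lrmorphism_pack (k : fieldType) (A C : algType k) (f : A -> C) :
  linear f -> f 1 = 1 -> {morph f : x y / x * y} ->
  exists h : {lrmorphism A -> C}, forall x, h x = f x.
Proof.
move=> fl f1 fM.
pose m := GRing.isLinear.Build k A C *:%R f fl.
pose mm := GRing.isMonoidMorphism.Build A C f (f1, fM).
by exists (HB.pack_for {lrmorphism A -> C} f m mm).
Qed.

(** * Reversibility and coinvariants of a twist *)

Section Transport.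
Variables (k : fieldType) (B : algType k) (H : hopf_algebroid B).
Variable P : comodule_algebra H.
Implicit Types (b : B).
Variables (phi : {linear H -> P}) (psi : {linear P -> H}).
Hypothesis phiK : cancel phi psi.
Hypothesis psiK : cancel psi phi.
Hypothesis phi_tgt : forall b (x : H), phi (tgt H b * x) = bar P b * phi x.
Hypothesis phi_coact : forall x : H,
  coact P (phi x) = tsum (comul H x) (fun x1 x2 => phi x1 ⊠ x2).

Notation f := (fun (b : B) (p : P) => bar P b * p).
Notation g := (fun (b : B) (x : H) => src H b * x).
Notation f' := (fun (b : B) (p : P) => p * bar P b).
Notation g' := (fun (b : B) (x : H) => tgt H b * x).
Notation PH := (diamond (src H) (bar P)).
Notation HH := (diamond (src H) (tgt H)).
Notation PtH := (balanced_tensor (bar P) (tgt H)).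

(** The Galois map of P is [lambda] conjugated by phi (x) id on both sides. *)
Lemma trivialization_reversible : reversible P.
Proof.
have psi_tgt b p : psi (bar P b * p) = tgt H b * psi p :=
  psi_tgtM phiK psiK phi_tgt b p.
have psi_mtgt b p : psi (p * bar P b) = psi p * tgt H b :=
  psi_mul_tgt phiK psiK phi_tgt phi_coact b p.
have phi_mtgt b (x : H) : phi (x * tgt H b) = phi x * bar P b :=
  colinear_mul_tgt phi_tgt phi_coact b x.
pose T (z : PH) : HH := tsum z (fun a x => psi a ⊠ x).
pose T' (z : HH) : PH := tsum z (fun y x => phi y ⊠ x).
pose U (z : HtH H) : PtH := tsum z (fun y x => phi y ⊠ x).
pose U' (z : PtH) : HtH H := tsum z (fun a x => psi a ⊠ x).
have TB : balanced f g (fun a x => psi a ⊠ x : HH).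
  by balance; rewrite psi_tgt ten_bal.
have T'B : balanced g' g (fun y x => phi y ⊠ x : PH).
  by balance; rewrite phi_tgt ten_bal.
have UB : balanced (fun b (x : H) => x * tgt H b) g'
    (fun y x => phi y ⊠ x : PtH).
  by balance; rewrite phi_mtgt ten_bal.
have U'B : balanced f' g' (fun a x => psi a ⊠ x : HtH H).
  by balance; rewrite psi_mtgt ten_bal.
have TK : cancel T T'.
  move=> z; rewrite /T' /T tsum_tsum // -[RHS]tsum_id.
  by apply: eq_tsum => a x; rewrite tsum_ten // psiK.
have T'K : cancel T' T.
  move=> z; rewrite /T' /T tsum_tsum // -[RHS]tsum_id.
  by apply: eq_tsum => a x; rewrite tsum_ten // phiK.
have U'K : cancel U' U.
  move=> z; rewrite /U' /U tsum_tsum // -[RHS]tsum_id.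
  by apply: eq_tsum => a x; rewrite tsum_ten // psiK.
have canU w : can (coact P) (U w) = T' (lambda w).
  have -> : lambda w = tsum w (fun y z =>
      tsum (comul H y) (fun y1 y2 => y1 ⊠ (y2 * z))).
    exact: (can_sumE (P := regular H)).
  rewrite /T' tsum_tsum // /U.
  rewrite (linear_tsum (L := can (coact P))); last exact: can_lin.
  apply: eq_tsum => y z; rewrite can_ten (tsum_coact_colinear phi_coact).
    by rewrite tsum_tsum //; apply: eq_tsum => ? ?; rewrite tsum_ten.
  exact/testMr/ten_balanced.
exists (fun z => U (lambda_inv (T z))) => z.
  rewrite -{1}(U'K z) canU T'K.
  by rewrite (@lambdaK k B H) U'K.
by rewrite canU (@lambda_invK k B H) TK.
Qed.
End Transport.

Lemma iso_twist_anti_cleft (k : fieldType) (B : algType k)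
    (H : hopf_algebroid B) (P : comodule_algebra H) (G : {linear HtH H -> B}) :
  invertible_cocycle G -> iso_twist P G -> anti_cleft_extension P.
Proof.
case=> [[G_bimod _ G1l _]] [G' [G'_bimod G'_tgt GG' G'G]].
case=> phi [[psi' phiK' psiK']] phi1 phiM phi_bar phi_coact'.
have phi_coact (x : H) :
    coact P (phi x) = tsum (comul H x) (fun x1 x2 => phi x1 ⊠ x2).
  by rewrite phi_coact' tsumE; apply: eq_tsum => ? ?; rewrite tenE.
have [psi psiE] := linear_pack (GRing.can2_linear phiK' psiK').
have phiK : cancel phi psi by move=> x; rewrite psiE.
have psiK : cancel psi phi by move=> x; rewrite psiE.
pose Gx (x y : H) := G (x ⊠ y).
have Gl y : linear (Gx^~ y) by rewrite /Gx; lin.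
have Gr x : linear (Gx x) by rewrite /Gx; lin.
have G_srcl b x y : Gx (src H b * x) y = b * Gx x y.
  have := G_bimod b 1 x y; rewrite !tenE (rmorph1 (tgt H)) !mulr1.
  exact.
have G_tgtl b x y : Gx (tgt H b * x) y = Gx x y * b.
  have := G_bimod 1 b x y; rewrite !tenE rmorph1 !mul1r.
  exact.
have G_bal b x y : Gx (x * tgt H b) y = Gx x (tgt H b * y).
  by rewrite /Gx ten_bal.
have G1 x : Gx 1 x = counit H x by rewrite -G1l tenE.
have tmE x y : twist_mul G x y = tsum (comul H y) (fun y1 y2 =>
    tsum (comul H x) (fun x1 x2 => src H (Gx x1 y1) * x2 * y2)).
  rewrite /twist_mul sweedler2E; apply: eq_tsum => y1 y2.
  by apply: eq_tsum => x1 x2; rewrite tenE.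
have tm_test y1 y2 : balanced (fun b (x : H) => tgt H b * x)
    (fun b (x : H) => src H b * x) (fun x1 x2 => src H (Gx x1 y1) * x2 * y2).
  by balance; rewrite G_tgtl rmorphM !mulrA.
(* Because Gamma(1, x) = eps(x), left twisted multiplication by s(b) or t(b) is the ordinary one;
   this makes [phi] linear on both sides and b |-> phi(s(b)) multiplicative. *)
have tm_src b x : twist_mul G (src H b) x = src H b * x.
  rewrite tmE comul_src -[in RHS](tsum_counitl x) tsum_mull.
  apply: eq_tsum => x1 x2; rewrite tsum_ten //.
  by rewrite -[src H b]mulr1 G_srcl G1 !mulr1 rmorphM mulrA.
have tm_tgt b x : twist_mul G (tgt H b) x = tgt H b * x.
  rewrite tmE comul_tgt tenE -[in RHS](tsum_counitl x) tsum_mull.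
  apply: eq_tsum => x1 x2; rewrite tsum_ten //.
  by rewrite G1 src_tgtC mulrA.
have phi_tgt b x : phi (tgt H b * x) = bar P b * phi x.
  by rewrite -tm_tgt phiM phi_bar.
have phi_srcM b x : phi (src H b * x) = phi (src H b) * phi x.
  by rewrite -tm_src phiM.
have [i iE] : exists i : {lrmorphism B -> P}, forall b, i b = phi (src H b).
  apply: lrmorphism_pack; first by lin.
    by rewrite rmorph1.
  by move=> b c; rewrite rmorphM phi_srcM.
have phi_src b x : phi (src H b * x) = i b * phi x by rewrite iE phi_srcM.
have i_coinv b : coact P (i b) = i b ⊠ 1.
  rewrite iE phi_coact comul_src tsum_ten //; balance.
  by rewrite phi_tgt ten_bal.
(* The cocycle is recovered as the counit of the twisted product: eps(x_2 y_2) = eps(x_2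
   s(eps(y_2))), and the Takeuchi condition moves eps(y_2) into Gamma(x_1, y_1). *)
have GE x y : Gx x y = trace psi (phi x * phi y).
  rewrite /trace -phiM phiK tmE tsum_app.
  have tB y1 : balanced (fun b (x : H) => tgt H b * x)
      (fun b (x : H) => src H b * x)
      (fun x1 x2 => (Gx x1 y1 * counit H x2 : B)).
    by balance; rewrite G_tgtl counit_srcM mulrA.
  transitivity (tsum (comul H y) (fun y1 y2 => tsum (comul H x) (fun x1 x2 =>
      (Gx x1 (tgt H (counit H y2) * y1) * counit H x2 : B)))).
    rewrite tsum_exchange -[in LHS](tsum_counitr x).
    rewrite (linear_tsum (L := Gx^~ y)) //; apply: eq_tsum => x1 x2.
    rewrite G_tgtl -[in LHS](tsum_counitr y) (linear_tsum (L := Gx x1)) //.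
    by rewrite tsum_mulr.
  apply: eq_tsum => y1 y2; under eq_tsum do rewrite -G_bal.
  rewrite (tsum_comul_takeuchi (tB y1)) tsum_app; apply: eq_tsum => x1 x2.
  by rewrite counit_src -mulrA counit_srcM.
pose G'x (x y : H) : B := G' (x ⊠ y).
have G'l y : linear (G'x^~ y) by rewrite /G'x; lin.
have G'r x : linear (G'x x) by rewrite /G'x; lin.
have G'_bal b x y : G'x (x * src H b) y = G'x x (src H b * y).
  by rewrite /G'x ten_bal.
have G'_srcl b x y : G'x (src H b * x) y = b * G'x x y.
  have := G'_bimod b 1 x y; rewrite !tenE (rmorph1 (tgt H)) !mulr1.
  exact.
have G'_tgtl b x y : G'x (tgt H b * x) y = G'x x y * b.
  have := G'_bimod 1 b x y; rewrite !tenE rmorph1 !mul1r.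
  exact.
have G'_tgtr b x y : G'x x (tgt H b * y)
    = tsum (comul H x) (fun x1 x2 => (G'x x1 y * G'x x2 (tgt H b) : B)).
  rewrite /G'x -tenE G'_tgt tsumE; apply: eq_tsum => x1 x2.
  by rewrite !tenE.
have GG'x x y : tsum (comul H y) (fun y1 y2 => tsum (comul H x) (fun x1 x2 =>
    (trace psi (phi x1 * phi y1) * G'x x2 y2 : B)))
    = trace psi (phi x * phi (src H (counit H y))).
  rewrite -GE /Gx -tenE -GG' sweedler2E; apply: eq_tsum => y1 y2.
  by apply: eq_tsum => x1 x2; rewrite -GE !tenE.
have G'Gx x y : tsum (comul H y) (fun y1 y2 => tsum (comul H x) (fun x1 x2 =>
    (G'x x1 y1 * trace psi (phi x2 * phi y2) : B))) = counit H (x * y).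
  rewrite -G'G sweedler2E; apply: eq_tsum => y1 y2.
  by apply: eq_tsum => x1 x2; rewrite -GE !tenE.
have [r [r_tgt r_src phi_r r_phi]] := cocycle_cleaving i_coinv phiK psiK phi1
  phi_tgt phi_src phi_coact G'l G'r G'_bal G'_srcl G'_tgtl G'_tgtr GG'x G'Gx.
exists i; split; last first.
  (* For coinvariant p, the expansion [tsum_trace] has the single term i(trace(p)) phi(1). *)
  move=> p; rewrite /coinvariant tenE => pc; exists (trace psi p).
  rewrite -[RHS](tsum_trace phiK psiK phi_tgt phi_src phi_coact) pc tsum_ten.
    by rewrite phi1 mulr1.
  exact: (trace_test_balanced phiK psiK phi_tgt phi_src).
split.
- exact: (trivialization_reversible phiK psiK phi_tgt phi_coact).
- by move=> b c /(congr1 (trace psi)); rewrite !(trace_src phiK phi1 phi_src).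
- by move=> b; rewrite /coinvariant tenE.
exists phi; split=> //; exists r; split=> // x.
- by rewrite /translp tenE tsumE.
- by rewrite /transrp tenE tsumE.
Qed.

Theorem corollary4p16 (k : fieldType) (B : algType k) (H : hopf_algebroid B)
    (P : comodule_algebra H) :
  anti_cleft_extension P <->
  exists G : {linear HtH H -> B}, invertible_cocycle G /\ iso_twist P G.
Proof.
split; first exact: anti_cleft_extension_cocycle.
by case=> G [Gi Gt]; exact: (iso_twist_anti_cleft Gi Gt).
Qed.
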